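(* Let $\Sigma_A$ be an affine system on a connected Lie group $G$, given by affine vector fields $F^0,F^1,\ldots,F^m$, with induced bilinear system $\Sigma_B$. Let $\omega\in\mathcal{U}$ be a piecewise constant control function and let $t_1,\ldots,t_n>t_0=0$ and $v_1,\ldots,v_n\in\mathbb{R}^m$ be such that $\omega(t)=v_i$ for $t\in\left(\sum_{j=0}^{i-1}t_j,\sum_{j=0}^{i}t_j\right]$, $i=1,\ldots,n$. For $u=(u_1,\ldots,u_m)\in\mathbb{R}^m$ let $\{\alpha^u_t\}_{t\in\mathbb{R}}$ be the flow of the affine vector field $F_u:=F^0+\sum_{j=1}^m u_jF^j$. Then for every $x\in G$ and $i\in\{1,\ldots,n\}$, $$\varphi^A(t,x,\omega)=\alpha^{v_i}_{t-\sum_{j=1}^{i-1}t_j}\left(\alpha^{v_{i-1}}_{t_{i-1}}\left(\cdots\left(\alpha^{v_1}_{t_1}(x)\right)\cdots\right)\right),\qquad t\in\left(\sum_{j=0}^{i-1}t_j,\ \sum_{j=0}^{i}t_j\right].$$ Moreover, the solutions of $\Sigma_A$ are complete (defined for all $t\in\mathbb{R}$), and for all $t\in\mathbb{R}$ and $\omega\in\mathcal{U}$ $$\varphi^A_{t,\omega}=L_{\varphi^A_{t,\omega}(e)}\circ\varphi^B_{t,\omega}.$$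
   Context: $G$ is a connected (finite-dimensional real) Lie group with identity $e$; $L_g$ denotes left translation by $g$. The Lie algebra $\mathfrak{g}$ is identified with the set of right-invariant vector fields on $G$. A smooth vector field $F$ on $G$ is affine if $[F,Y]\in\mathfrak{g}$ for all $Y\in\mathfrak{g}$; it is linear if it is affine and $F(e)=0$. Every affine vector field is complete and decomposes uniquely as $F=\mathcal{X}+Y$ with $\mathcal{X}$ linear and $Y$ right-invariant. The flow of a linear vector field is a one-parameter subgroup of $\mathrm{Aut}(G)$. $\mathcal{U}$ is the set of piecewise constant functions $\omega=(\omega_1,\ldots,\omega_m):\mathbb{R}\to\mathbb{R}^m$. An affine system on $G$ is the family $$\dot g(t)=F^0(g(t))+\sum_{j=1}^m\omega_j(t)F^j(g(t)),\qquad\omega\in\mathcal{U}\qquad(\Sigma_A),$$ with $F^0,\ldots,F^m$ affine vector fields. Writing $F^j=\mathcal{X}^j+Y^j$ with $\mathcal{X}^j$ linear and $Y^j$ right-invariant, the bilinear system induced by (associated with) $\Sigma_A$ is $$\dot g(t)=\mathcal{X}^0(g(t))+\sum_{j=1}^m\omega_j(t)\mathcal{X}^j(g(t)),\qquad\omega\in\mathcal{U}\qquad(\Sigma_B).$$ $\varphi^A(t,g,\omega)$ and $\varphi^B(t,g,\omega)$ denote the (continuous) solutions of $\Sigma_A$ and $\Sigma_B$ with control $\omega$ and value $g$ at $t=0$, and $\varphi^A_{t,\omega}(g):=\varphi^A(t,g,\omega)$, $\varphi^B_{t,\omega}(g):=\varphi^B(t,g,\omega)$. *)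

(* Defs.v *)
From HB Require Import structures.
From mathcomp Require Import all_boot all_order all_algebra.
From mathcomp Require Import all_classical all_reals all_analysis.

Set Implicit Arguments.
Unset Strict Implicit.
Unset Printing Implicit Defensive.

Import Order.TTheory GRing.Theory Num.Theory.
Import numFieldNormedType.Exports.

Local Open Scope classical_set_scope.
Local Open Scope ring_scope.

(** * Smooth maps between open subsets of normed spaces *)

(* Meant for open [A]: the derivatives at a point of [A] then depend only on
   the restriction of [f] to [A]. *)
Fixpoint Ck (R : realType) (V W : normedModType R) (k : nat) (A : set V)
    (f : V -> W) : Prop :=
  match k with
  | 0%N => forall x, A x -> {for x, continuous f}
  | k'.+1 => (forall x, A x -> differentiable f x) /\
             (forall v, Ck k' A (fun x => 'D_v f x))
  end.

Definition smooth_on (R : realType) (V W : normedModType R) (A : set V)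
    (f : V -> W) : Prop := forall k, Ck k A f.

(** * Smooth manifolds of dimension [d] *)

(* A homeomorphism from the open set [chart_dom] onto an open subset of R^d.
   [chart_map] and [chart_inv] are total; their values away from [chart_dom]
   and from its image are irrelevant. *)
Record chart_on (R : realType) (d : nat) (M : topologicalType) := ChartOn {
  chart_dom : set M;
  chart_map :> M -> 'rV[R]_d;
  chart_inv : 'rV[R]_d -> M;
  chart_dom_open : open chart_dom;
  chart_img_open : open (chart_map @` chart_dom);
  chart_mapK : forall p, chart_dom p -> chart_inv (chart_map p) = p;
  chart_map_continuous : forall p, chart_dom p -> {for p, continuous chart_map};
  chart_inv_continuous : forall x, (chart_map @` chart_dom) x ->
    {for x, continuous chart_inv}
}.

Definition chart_img (R : realType) (d : nat) (M : topologicalType)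
    (c : chart_on R d M) : set 'rV[R]_d := c @` chart_dom c.

Definition compatible_charts (R : realType) (d : nat) (M : topologicalType)
    (c1 c2 : chart_on R d M) : Prop :=
  smooth_on (c1 @` (chart_dom c1 `&` chart_dom c2)) (c2 \o chart_inv c1).

HB.mixin Record isSmoothManifold (R : realType) (d : nat) M
    of Topological M := {
  atlas_index : Type;
  atlas : atlas_index -> chart_on R d M;
  atlas_cover : forall p : M, exists i, chart_dom (atlas i) p;
  atlas_compatible : forall i j, compatible_charts (atlas i) (atlas j);
  manifold_hausdorff : hausdorff_space M;
  manifold_second_countable : @second_countable M
}.

#[short(type="smoothManifoldType")]
HB.structure Definition SmoothManifold (R : realType) (d : nat) :=
  { M of Topological M & isSmoothManifold R d M }.

Arguments atlas_index {R d} M : rename.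
Arguments atlas {R d M} i : rename.

(** * Lie groups *)

HB.mixin Record isLieGroup (R : realType) (d : nat) G
    of SmoothManifold R d G & Group G := {
  lie_mul_continuous : continuous (fun z : G * G => (z.1 * z.2)%g);
  lie_mul_smooth : forall i j k : atlas_index G,
    smooth_on
      [set z : 'rV[R]_d * 'rV[R]_d |
        [/\ chart_img (atlas i) z.1, chart_img (atlas j) z.2 &
            chart_dom (atlas k)
              (chart_inv (atlas i) z.1 * chart_inv (atlas j) z.2)%g]]
      (fun z => atlas k
         (chart_inv (atlas i) z.1 * chart_inv (atlas j) z.2)%g);
  lie_inv_continuous : continuous (fun g : G => (g^-1)%g);
  lie_inv_smooth : forall i j : atlas_index G,
    smooth_on
      [set x : 'rV[R]_d |
        chart_img (atlas i) x /\
        chart_dom (atlas j) ((chart_inv (atlas i) x)^-1)%g]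
      (fun x => atlas j ((chart_inv (atlas i) x)^-1)%g)
}.

#[short(type="lieGroupType")]
HB.structure Definition LieGroup (R : realType) (d : nat) :=
  { G of SmoothManifold R d G & Group G & isLieGroup R d G }.

(** * Vector fields *)

(* [F i p] is the coordinate vector, in the chart [i], of the value at [p] of
   the vector field [F]; it is meaningful only when [p] lies in the domain of
   [i]. *)
Definition vfield (R : realType) (d : nat) (M : smoothManifoldType R d) :=
  atlas_index M -> M -> 'rV[R]_d.

(* The differential of [h] at [p] in the charts [i] (at [p]) and [j] (at
   [h p]), applied to the coordinate vector [v]. *)
Definition tangent_map (R : realType) (d : nat) (M : smoothManifoldType R d)
    (h : M -> M) (i j : atlas_index M) (p : M) (v : 'rV[R]_d) : 'rV[R]_d :=
  'D_v (fun x => atlas j (h (chart_inv (atlas i) x))) (atlas i p).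

Definition smooth_vfield (R : realType) (d : nat) (M : smoothManifoldType R d)
    (F : vfield M) : Prop :=
  (forall i j p, chart_dom (atlas i) p -> chart_dom (atlas j) p ->
     F j p = tangent_map id i j p (F i p)) /\
  (forall i, smooth_on (chart_img (atlas i)) (F i \o chart_inv (atlas i))).

Definition eq_vfield (R : realType) (d : nat) (M : smoothManifoldType R d)
    (F H : vfield M) : Prop :=
  forall i p, chart_dom (atlas i) p -> F i p = H i p.

Definition add_vfield (R : realType) (d : nat) (M : smoothManifoldType R d)
    (F H : vfield M) : vfield M := fun i p => F i p + H i p.

Definition lie_bracket (R : realType) (d : nat) (M : smoothManifoldType R d)
    (F H : vfield M) : vfield M := fun i p =>
  'D_(F i p) (H i \o chart_inv (atlas i)) (atlas i p)
  - 'D_(H i p) (F i \o chart_inv (atlas i)) (atlas i p).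

(* The vector fields satisfying this predicate form the Lie algebra of [G]. *)
Definition right_invariant (R : realType) (d : nat) (G : lieGroupType R d)
    (Y : vfield G) : Prop :=
  smooth_vfield Y /\
  forall (g p : G) i j,
    chart_dom (atlas i) p -> chart_dom (atlas j) (p * g)%g ->
    Y j (p * g)%g = tangent_map (fun x : G => (x * g)%g) i j p (Y i p).

Definition affine_vfield (R : realType) (d : nat) (G : lieGroupType R d)
    (F : vfield G) : Prop :=
  smooth_vfield F /\
  forall Y, right_invariant Y -> right_invariant (lie_bracket F Y).

Definition linear_vfield (R : realType) (d : nat) (G : lieGroupType R d)
    (F : vfield G) : Prop :=
  affine_vfield F /\
  forall i, chart_dom (atlas i) (1%g : G) -> F i (1%g : G) = 0.

(** * Integral curves and flows *)

(* The continuity requirement is not redundant: away from its domain, a chart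
   takes arbitrary values. *)
Definition has_velocity (R : realType) (d : nat) (M : smoothManifoldType R d)
    (F : vfield M) (c : R -> M) (t : R) : Prop :=
  {for t, continuous c} /\
  forall i, chart_dom (atlas i) (c t) ->
    is_derive t (1 : R) (fun s => atlas i (c s)) (F i (c t)).

Definition is_flow (R : realType) (d : nat) (M : smoothManifoldType R d)
    (F : vfield M) (alpha : R -> M -> M) : Prop :=
  forall x, alpha 0 x = x /\ forall t, has_velocity F (alpha ^~ x) t.

(** * Control systems *)

(* Every compact interval has a finite subdivision such that the function is
   constant on the interior of each piece; the values at the subdivision
   points are unconstrained. *)
Definition piecewise_constant (R : realType) (T : Type) (w : R -> T) : Prop :=
  forall a b : R, a < b -> exists s : seq R, itv_partition a b s /\
    forall k, (k < size s)%N -> forall x y,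
      nth b (a :: s) k < x < nth b (a :: s) k.+1 ->
      nth b (a :: s) k < y < nth b (a :: s) k.+1 -> w x = w y.

(* [F ord0] is the drift F^0 and [F (lift ord0 j)] is the control vector field
   whose coefficient is the [j]-th component of [u]. *)
Definition system_field (R : realType) (d m : nat) (M : smoothManifoldType R d)
    (F : 'I_m.+1 -> vfield M) (u : 'rV[R]_m) : vfield M :=
  fun i p => F ord0 i p + \sum_(j < m) u 0 j *: F (lift ord0 j) i p.

(* The differential equation is required at the times around which the control
   is constant, i.e. away from its switching times. *)
Definition system_solution (R : realType) (d m : nat)
    (M : smoothManifoldType R d) (F : 'I_m.+1 -> vfield M)
    (w : R -> 'rV[R]_m) (J : set R) (c : R -> M) : Prop :=
  forall t, J t ->
    {for t, continuous c} /\
    ((\forall s \near t, w s = w t) -> has_velocity (system_field F (w t)) c t).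

(* The maximal solution through any point is defined on the whole line: a
   global solution exists and extends every solution on an open interval. *)
Definition complete_system (R : realType) (d m : nat)
    (M : smoothManifoldType R d) (F : 'I_m.+1 -> vfield M) : Prop :=
  forall (w : R -> 'rV[R]_m) (g : M), piecewise_constant w ->
  exists c : R -> M,
    [/\ system_solution F w setT c, c 0 = g &
        forall (J : set R) (c' : R -> M),
          open J -> is_interval J -> J 0 ->
          system_solution F w J c' -> c' 0 = g ->
          forall t, J t -> c' t = c t].

(* [phi t g w] is the value at time [t] of the solution with control [w] that
   passes through [g] at time 0. *)
Definition solution_map (R : realType) (d m : nat)
    (M : smoothManifoldType R d) (F : 'I_m.+1 -> vfield M)
    (phi : R -> M -> (R -> 'rV[R]_m) -> M) : Prop :=
  forall g w, piecewise_constant w ->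
    system_solution F w setT (fun t => phi t g w) /\ phi 0 g w = g.

Definition left_translation (R : realType) (d : nat) (G : lieGroupType R d)
    (g : G) : G -> G := fun x => (g * x)%g.

(* [alpha (v k) (tau k) (... (alpha (v 1) (tau 1) x))] *)
Fixpoint flow_concat (R : realType) (U M : Type) (alpha : U -> R -> M -> M)
    (v : nat -> U) (tau : nat -> R) (k : nat) (x : M) : M :=
  match k with
  | 0%N => x
  | k'.+1 => alpha (v k'.+1) (tau k'.+1) (flow_concat alpha v tau k' x)
  end.

(* Main.v *)
Require Import Defs.
From mathcomp Require Import all_boot all_order all_algebra.
From mathcomp Require Import all_classical all_reals all_analysis.
From mathcomp Require Import ring lra.
Import Order.TTheory GRing.Theory Num.Theory.
Import numFieldNormedType.Exports.
Local Open Scope classical_set_scope.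
Local Open Scope ring_scope.
Set Implicit Arguments.
Unset Strict Implicit.

(** For a constant control [u] let [F_u] and [X_u] be the fields of the affine
    system and of the bilinear one. Everything rests on the identity

      [F_u (a b) = dR_b (F_u a) + dL_a (X_u b)]   ([mul_related]),

    where [R_b] and [L_a] are the translations: it says that an integral curve
    of [F_u] times an integral curve of [X_u] is an integral curve of [F_u].

    - The solution of the affine system through 1 times the solution of the
      bilinear one through [g] therefore solves the affine system, and by
      uniqueness ([solution_unique]) it is the solution through [g].
    - With [X_u] in place of [F_u], the identity shows that the points through
      which [X_u] has an integral curve over a given interval [(-e, e)] are
      stable under products. For small [e] they contain a neighborhood of 1,
      hence they are the whole connected group ([linear_uniform_flow]), and
      [F_u] inherits this ([affine_uniform_flow]). A time of existence that
      does not depend on the starting point gives solutions over the whole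
      line ([solution_reaches]).
    - The formula in terms of flows is uniqueness on each of the intervals where
      the control is constant ([solution_on_segment]).

    For a right-invariant field [Y], the identity [Y (a b) = dR_b (Y a)] is the
    definition, so it remains to treat a linear field [X]. Fix [b] and consider
    [E a = X (a b) - dR_b (X a) - dL_a (X b)], which vanishes at 1. In charts,
    differentiate [E] along a right-invariant field [Y]: since [[X, Y]] is
    right-invariant too, the symmetry of the second derivatives of the
    multiplication leaves [D_Y E = D_E Y] ([derive_discrepancy]). The values of
    the right-invariant fields fill every tangent space ([rext_surjective]), so
    [|DE| <= C |E|] locally and the zeros of [E] form an open set
    ([locally_zero]). This set is also closed and contains 1; [G] being
    connected, it is all of [G] ([linear_mul_related]). *)

(** * Differential calculus on spaces of row vectors *)

Lemma ler_coord (R : realType) (n : nat) (x : 'rV[R]_n) j : `|x 0 j| <= `|x|.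
Proof.
rewrite {2}/Num.Def.normr/= mx_normrE.
exact: (le_bigmax _ (fun i : 'I_1 * 'I_n => `|x i.1 i.2|) (0, j)).
Qed.

Lemma ler_normv (R : realType) (n : nat) (x : 'rV[R]_n) e : 0 <= e ->
  (forall j, `|x 0 j| <= e) -> `|x| <= e.
Proof.
move=> e0 xe; rewrite /Num.Def.normr/= mx_normrE (bigmax_le _ e0)//= => -[i j] _.
by rewrite ord1.
Qed.

Lemma near_itv (R : realType) (a b t : R) : a < t < b ->
  \forall s \near t, a < s < b.
Proof.
move=> tab; have := @near_in_itvoo R a b t; rewrite in_itv /= => /(_ tab).
by apply: filterS => s; rewrite in_itv.
Qed.

Lemma is_derive_line (R : realType) (V W : normedModType R) (f : V -> W)
    (x u : V) (t : R) : differentiable f (x + t *: u) ->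
  is_derive t 1 (fun s => f (x + s *: u)) ('D_u f (x + t *: u)).
Proof.
move=> df.
have dg : is_diff t (fun s : R => x + s *: u) (fun s : R => s *: u).
  have := @is_diffD R R V (cst x) (fun s => s *: u) 0 (fun s => s *: u) t.
  by rewrite add0r; apply.
have dfg : differentiable (fun s : R => f (x + s *: u)) t.
  exact: (@differentiable_comp _ R V W (fun s => x + s *: u) f t).
apply: DeriveDef; first exact: diff_derivable.
rewrite deriveE// (@diff_comp _ R V W (fun s => x + s *: u) f t)//=.
by rewrite diff_val scale1r deriveE.
Qed.

Lemma derive_chain (R : realType) (U V W : normedModType R) (g : U -> V)
    (f : V -> W) (x v : U) : differentiable g x -> differentiable f (g x) ->
  'D_v (fun z => f (g z)) x = 'D_('D_v g x) f (g x).
Proof.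
move=> dg df; rewrite deriveE; last exact: differentiable_comp.
by rewrite (diff_comp (f := g))//= !deriveE.
Qed.

Lemma is_derive_chain (R : realType) (V W : normedModType R) (c : R -> V)
    (f : V -> W) (t : R) (v : V) : is_derive t 1 c v ->
  differentiable f (c t) -> is_derive t 1 (fun s => f (c s)) ('D_v f (c t)).
Proof.
move=> dc df; have dct : differentiable c t by apply/derivable1_diffP; case: dc.
apply: DeriveDef; last by rewrite derive_chain//; case: dc => _ ->.
exact/diff_derivable/differentiable_comp.
Qed.

Lemma derive_coord (R : realType) (V : normedModType R) (n : nat)
    (f : V -> 'rV[R]_n) (x v : V) j : derivable f x v ->
  ('D_v f x) 0 j = 'D_v (fun z => f z 0 j) x.
Proof. by move=> /derive_mx ->; rewrite mxE. Qed.

Lemma differentiable_row (R : realType) (V : normedModType R) (n : nat)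
    (f : V -> 'rV[R]_n) (x : V) :
  (forall j, differentiable (fun z => f z 0 j) x) -> differentiable f x.
Proof.
move=> df.
have -> : f = \sum_(j < n) (fun z => f z 0 j *: (delta_mx 0 j : 'rV[R]_n)).
  by apply/funext => z; rewrite fct_sumE; exact: row_sum_delta.
by apply: differentiable_sum => j; exact: differentiableZl.
Qed.

Lemma differentiable_row_coord (R : realType) (V : normedModType R) (n : nat)
    (f : V -> 'rV[R]_n) (x : V) j :
  differentiable f x -> differentiable (fun z => f z 0 j) x.
Proof.
move=> df; apply: (differentiable_comp (g := fun M : 'rV[R]_n => M 0 j) df).
exact: (differentiable_coord (f x) 0 j).
Qed.

Lemma MVT_le (R : realType) (n : nat) (f : R -> 'rV[R]_n) (a b K : R) :
  a <= b -> 0 <= K -> {within `[a, b], continuous f} ->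
  (forall t, a < t < b -> exists2 v, is_derive t 1 f v & `|v| <= K) ->
  `|f b - f a| <= K * (b - a).
Proof.
rewrite le_eqVlt => /predU1P[->|ab] K0 cf df.
  by rewrite !subrr normr0 mulr0.
apply: ler_normv => [|j]; first by rewrite mulr_ge0// subr_ge0 ltW.
have cfj : {within `[a, b], continuous (fun t => f t 0 j)}.
  move=> t; apply: (@continuous_comp (subspace `[a, b]) _ _ f (fun M : 'rV[R]_n => M 0 j)).
    exact: cf.
  exact: coord_continuous.
have [t|//|c cab] := @MVT _ (fun t => f t 0 j) (fun t => ('D_1 f t) 0 j) a b ab.
  rewrite in_itv /= => /df[v [fv _] _].
  by apply: DeriveDef; [move/derivable_mxP: fv; exact | rewrite derive_coord].
rewrite !mxE => ->; rewrite normrM [`|b - a|]ger0_norm ?subr_ge0 ?(ltW ab)//.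
rewrite ler_wpM2r ?subr_ge0 ?(ltW ab)//.
move: cab; rewrite in_itv /= => /df[v [_ ->]]; apply: le_trans.
exact: ler_coord.
Qed.

(** On so short an interval the maximum [M] of [|f|] satisfies [M <= M / 2]. *)
Lemma gronwall_short (R : realType) (n : nat) (f : R -> 'rV[R]_n) (a b L : R) :
  0 <= L -> L * (b - a) <= 1 / 2 -> {within `[a, b], continuous f} -> f a = 0 ->
  (forall t, a < t < b -> exists2 v, is_derive t 1 f v & `|v| <= L * `|f t|) ->
  forall t, a <= t <= b -> f t = 0.
Proof.
move=> L0 Lab cf fa df t /andP[at_ tb].
have ab : a <= b by apply: le_trans tb.
have cnf : {within `[a, b], continuous (fun t => `|f t|)}.
  move=> s; apply: (@continuous_comp (subspace `[a, b]) _ _ f (fun M : 'rV[R]_n => `|M|)).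
    exact: cf.
  exact: norm_continuous.
have [c] := EVT_max ab cnf; rewrite in_itv /= => /andP[ac cb] cmax.
have : `|f c - f a| <= L * `|f c| * (c - a).
  apply: MVT_le => //; first by rewrite mulr_ge0.
    by apply: continuous_subspaceW cf; apply: subset_itvl; rewrite bnd_simp.
  move=> s /andP[as_ sc]; have [|v fv vL] := df s.
    by rewrite as_ (lt_le_trans sc).
  exists v => //; apply: (le_trans vL); rewrite ler_wpM2l// cmax// in_itv /=.
  by rewrite ltW//= ltW// (lt_le_trans sc).
rewrite fa subr0 => fc.
have fc0 : `|f c| = 0.
  apply/eqP; rewrite eq_le normr_ge0 andbT.
  have : L * `|f c| * (c - a) <= 1 / 2 * `|f c|.
    rewrite mulrAC ler_wpM2r//; apply: le_trans Lab.
    by rewrite ler_wpM2l// lerB.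
  lra.
apply/eqP; rewrite -normr_le0 -fc0; apply: cmax.
by rewrite in_itv /= at_.
Qed.

Lemma differentiable_within (R : realType) (V : normedModType R) (f : R -> V)
    (A : set R) : (forall t, A t -> {for t, continuous f}) ->
  {within A, continuous f}.
Proof. by move=> cf; apply: continuous_in_subspaceT => t /[!inE] /cf. Qed.

Lemma Ck_differentiable (R : realType) (V W : normedModType R) (k : nat)
    (A : set V) (f : V -> W) (x : V) : Ck k.+1 A f -> A x -> differentiable f x.
Proof. by move=> -[df _] /df. Qed.

Lemma deriveD_dir (R : realType) (V W : normedModType R) (f : V -> W)
    (x u v : V) : differentiable f x -> 'D_(u + v) f x = 'D_u f x + 'D_v f x.
Proof. by move=> df; rewrite !deriveE// linearD. Qed.

Lemma deriveB_dir (R : realType) (V W : normedModType R) (f : V -> W)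
    (x u v : V) : differentiable f x -> 'D_(u - v) f x = 'D_u f x - 'D_v f x.
Proof. by move=> df; rewrite !deriveE// linearB. Qed.

Lemma derive_row_sum (R : realType) (n : nat) (W : normedModType R)
    (f : 'rV[R]_n -> W) (x u : 'rV[R]_n) : differentiable f x ->
  'D_u f x = \sum_(j < n) u 0 j *: 'D_(delta_mx 0 j) f x.
Proof.
move=> df; rewrite deriveE// [in LHS](row_sum_delta u) linear_sum.
by apply: eq_bigr => j _; rewrite linearZ deriveE.
Qed.

(** The partial derivatives are continuous, hence bounded near [x]. *)
Lemma Ck1_bounded (R : realType) (n : nat) (W : normedModType R) (A : set 'rV[R]_n)
    (f : 'rV[R]_n -> W) (x : 'rV[R]_n) : open A -> Ck 1 A f -> A x ->
  exists2 C : R, 0 <= C &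
    \forall z \near x, forall v, `|'D_v f z| <= C * `|v|.
Proof.
move=> oA [df cf] Ax.
exists (\sum_(j < n) (`|'D_(delta_mx 0 j) f x| + 1)).
  by apply: sumr_ge0 => j _; rewrite addr_ge0.
near=> z => v; rewrite derive_row_sum; last first.
  by apply: df; near: z; exact: open_nbhs_nbhs.
rewrite (le_trans (ler_norm_sum _ _ _))// mulr_suml.
apply: ler_sum => j _; rewrite normrZ mulrC ler_pM ?ler_coord//.
move: j; near: z; apply: filter_forall => j.
have cj : `|'D_(delta_mx 0 j) f z| @[z --> x] --> `|'D_(delta_mx 0 j) f x|.
  by have c0 := cf (delta_mx 0 j) x Ax; exact: (cvg_norm c0).
apply: (cvgr_le _ cj); by rewrite ltrDl.
Unshelve. all: by end_near. Qed.

Lemma ball_segment (R : realType) (V : normedModType R) (c x y : V) (r t : R) :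
  ball c r x -> ball c r y -> 0 <= t <= 1 -> ball c r (x + t *: (y - x)).
Proof.
rewrite -!ball_normE /ball_ /= => cx cy /andP[t0 t1].
have -> : c - (x + t *: (y - x)) = (1 - t) *: (c - x) + t *: (c - y).
  rewrite scalerBl scale1r -addrA [- _ + _]addrC -scalerBr opprB.
  by rewrite [c - y + _]addrC addrA subrK opprD addrA -scalerN opprB.
rewrite (le_lt_trans (ler_normD _ _))// !normrZ !ger0_norm ?subr_ge0//.
have [->|t1'] := eqVneq t 1; first by rewrite subrr mul0r add0r mul1r.
have : (1 - t) * `|c - x| < (1 - t) * r.
  by rewrite ltr_pM2l// subr_gt0 lt_neqAle t1'.
have : t * `|c - y| <= t * r by rewrite ler_wpM2l// ltW.
lra.
Qed.

Lemma Ck1_lipschitz (R : realType) (n m : nat) (A : set 'rV[R]_n)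
    (f : 'rV[R]_n -> 'rV[R]_m) (x : 'rV[R]_n) : open A -> Ck 1 A f -> A x ->
  exists r L : R, [/\ 0 < r, 0 <= L, ball x r `<=` A &
    forall y z, ball x r y -> ball x r z -> `|f z - f y| <= L * `|z - y|].
Proof.
move=> oA Cf Ax; have [C C0 fC] := Ck1_bounded oA Cf Ax.
have : \forall z \near x, A z /\ forall v, `|'D_v f z| <= C * `|v|.
  by apply: filterI => //; exact: open_nbhs_nbhs.
move=> /nbhs_ballP[r r0 rA]; exists r, C; split=> //; first by move=> z /rA[].
move=> y z ry rz.
have dg (t : R) : 0 <= t <= 1 ->
    is_derive t 1 (fun s : R => f (y + s *: (z - y))) ('D_(z - y) f (y + t *: (z - y))).
  move=> t01; apply: is_derive_line; apply: (Ck_differentiable Cf).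
  by have [] := rA _ (ball_segment ry rz t01).
have := @MVT_le _ _ (fun s : R => f (y + s *: (z - y))) 0 1 (C * `|z - y|) ler01.
rewrite scale1r scale0r addr0 subr0 mulr1 [y + (z - y)]addrC subrK; apply.
- by rewrite mulr_ge0.
- apply: derivable_within_continuous => t; rewrite in_itv /= => t01.
  by case: (dg _ t01).
- move=> t /andP[t0 t1]; have t01 : 0 <= t <= 1 by rewrite !ltW.
  exists ('D_(z - y) f (y + t *: (z - y))); first exact: dg.
  by have [_] := rA _ (ball_segment ry rz t01); apply.
Qed.

(** * Symmetry of second derivatives *)

(** The mixed second difference of [g] along [u] and [v], by the mean value
    theorem in the direction [u] and then in the direction [v]. *)
Lemma second_difference (R : realType) (V : normedModType R)
    (g gu : V -> R) (x u v : V) (h : R) : 0 < h ->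
  (forall s t, 0 <= s <= h -> 0 <= t <= h ->
     [/\ differentiable g (x + s *: u + t *: v),
         'D_u g (x + s *: u + t *: v) = gu (x + s *: u + t *: v) &
         differentiable gu (x + s *: u + t *: v)]) ->
  exists s t, [/\ 0 <= s <= h, 0 <= t <= h &
    g (x + h *: u + h *: v) - g (x + h *: u) - (g (x + h *: v) - g x) =
      'D_v gu (x + s *: u + t *: v) * h * h].
Proof.
move=> h0 dg; have h0h : 0 <= h <= h by rewrite lexx ltW.
have z0h : 0 <= (0 : R) <= h by rewrite lexx ltW.
have dphi (t s : R) : 0 <= t <= h -> 0 <= s <= h ->
    is_derive s 1 (fun s => g (x + s *: u + t *: v))
      (gu (x + s *: u + t *: v)).
  move=> th sh; have -> : (fun s => g (x + s *: u + t *: v)) =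
      (fun s => g (x + t *: v + s *: u)).
    by apply/funext => s'; rewrite addrAC.
  have [dgz <- _] := dg s t sh th; rewrite addrAC.
  by apply: is_derive_line; rewrite addrAC.
have dpsi (s t : R) : 0 <= s <= h -> 0 <= t <= h ->
    is_derive t 1 (fun t => gu (x + s *: u + t *: v))
      ('D_v gu (x + s *: u + t *: v)).
  by move=> sh th; apply: is_derive_line; have [] := dg s t sh th.
pose phi (s : R) := g (x + s *: u + h *: v) - g (x + s *: u + 0 *: v).
pose dp s := gu (x + s *: u + h *: v) - gu (x + s *: u + 0 *: v).
have phid (s : R) : 0 <= s <= h -> is_derive s 1 phi (dp s).
  by move=> sh; apply: is_deriveB; exact: dphi.
have [s||s] := @MVT _ phi dp 0 h h0.
- by rewrite in_itv /= => /andP[s0 sh]; apply: phid; rewrite !ltW.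
- apply: derivable_within_continuous => s; rewrite in_itv /= => sh.
  by case: (phid _ sh).
- rewrite in_itv /= => /andP[s0 sh] phE.
  have {s0 sh} s0h : 0 <= s <= h by rewrite !ltW.
  have [t||t] := @MVT _ (fun t : R => gu (x + s *: u + t *: v))
      (fun t => 'D_v gu (x + s *: u + t *: v)) 0 h h0.
  - by rewrite in_itv /= => /andP[t0 th]; apply: dpsi => //; rewrite !ltW.
  - apply: derivable_within_continuous => t; rewrite in_itv /= => th.
    by case: (dpsi _ _ s0h th).
  - rewrite in_itv /= => /andP[t0 th] psE; exists s, t; split=> //.
      by rewrite !ltW.
    by move: phE; rewrite /phi /dp psE !subr0 !scale0r !addr0 => <-.
Qed.

Lemma near_second_difference (R : realType) (V : normedModType R) (x u v : V)
    (P : set V) : (\forall z \near x, P z) ->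
  \forall h \near (0 : R)^'+, forall s t, 0 <= s <= h -> 0 <= t <= h ->
    P (x + s *: u + t *: v).
Proof.
move=> /nbhs_ballP[e e0 eP]; near=> h => s t /andP[s0 sh] /andP[t0 th].
apply: eP; rewrite -ball_normE /ball_ /= -addrA opprD addrA subrr sub0r normrN.
rewrite (le_lt_trans (ler_normD _ _))// !normrZ !ger0_norm//.
have : s * `|u| + t * `|v| <= h * (`|u| + `|v| + 1).
  rewrite !mulrDr mulr1 -addrA lerD//; first by rewrite ler_wpM2r.
  by rewrite -[leLHS]addr0 lerD// ?ler_wpM2r// (le_trans s0 sh).
move=> /le_lt_trans; apply; rewrite -ltr_pdivlMr; last by rewrite ltr_wpDl ?addr_ge0.
near: h; apply: nbhs_right_lt; rewrite divr_gt0// ltr_wpDl// addr_ge0//.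
Unshelve. all: by end_near. Qed.

(** Schwarz: the mixed second difference of [f] is a value of either mixed
    derivative, and both are continuous. *)
Lemma derive_swap (R : realType) (V : normedModType R) (m : nat) (A : set V)
    (f : V -> 'rV[R]_m) (x u v : V) : open A -> Ck 2 A f -> A x ->
  'D_v ('D_u f) x = 'D_u ('D_v f) x.
Proof.
move=> oA [df Cf] Ax; apply/rowP => j.
have dfw w z : A z -> differentiable ('D_w f) z.
  by move=> Az; case: (Cf w) => /(_ z Az).
pose g z := f z 0 j; pose gw w z := ('D_w f z) 0 j.
have dg z : A z -> differentiable g z by move=> /df; exact: differentiable_row_coord.
have gwE w z : A z -> 'D_w g z = gw w z.
  by move=> /df dfz; rewrite /gw derive_coord//; exact: diff_derivable.
have dgw w z : A z -> differentiable (gw w) z.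
  by move=> /(dfw w); exact: differentiable_row_coord.
have gwwE w w' z : A z -> 'D_w' (gw w) z = ('D_w' ('D_w f) z) 0 j.
  by move=> /(dfw w) dfz; rewrite /gw derive_coord//; exact: diff_derivable.
pose dd w w' := ('D_w' ('D_w f) x) 0 j.
(* The second difference over a square of side [h] is [dd w w' * h * h] up to
   [e * h * h]; it is symmetric in the two directions. *)
have key w w' (e : R) : 0 < e -> \forall h \near (0 : R)^'+,
    `|(g (x + h *: w + h *: w') - g (x + h *: w) - (g (x + h *: w') - g x))
      - dd w w' * h * h| <= e * h * h.
  move=> e0; have cww : {for x, continuous (fun z => ('D_w' ('D_w f) z) 0 j)}.
    apply: (@continuous_comp _ _ _ ('D_w' ('D_w f)) (fun M : 'rV[R]_m => M 0 j)).
      by have [_ /(_ w')] := Cf w; apply.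
    exact: coord_continuous.
  have nA : \forall z \near x, A z /\
      `|dd w w' - ('D_w' ('D_w f) z) 0 j| <= e.
    apply: filterI; first exact: open_nbhs_nbhs.
    by move/cvgrPdist_le : cww; apply.
  near=> h; have h0 : 0 < h by near: h; exact: nbhs_right_gt.
  have hA : forall s t, 0 <= s <= h -> 0 <= t <= h ->
      A (x + s *: w + t *: w') /\
      `|dd w w' - ('D_w' ('D_w f) (x + s *: w + t *: w')) 0 j| <= e.
    by near: h; exact: near_second_difference nA.
  have [s t sh th|s [t [sh th ->]]] := @second_difference _ _ g (gw w) x w w' h h0.
    by have [Az _] := hA s t sh th; split; [exact: dg|exact: gwE|exact: dgw].
  have [Az le_e] := hA s t sh th; rewrite gwwE// -!mulrBl -!mulrA normrM.
  rewrite [`|h * h|]ger0_norm; last by rewrite mulr_ge0 ?ltW.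
  by rewrite distrC; apply: ler_wpM2r => //; rewrite mulr_ge0 ?ltW.
suff : dd u v = dd v u by [].
clearbody dd; apply/eqP; rewrite -subr_eq0 -normr_le0; apply/ler_addgt0Pr => e e0.
rewrite add0r; have e20 : 0 < e / 2 by rewrite divr_gt0.
have [h [h0 [k1 k2]]] := filter_ex (filterI (nbhs_right_gt (0 : R))
  (filterI (key u v _ e20) (key v u _ e20))).
have hh0 : 0 < h * h by rewrite mulr_gt0.
have vuE : x + h *: v + h *: u = x + h *: u + h *: v by rewrite addrAC.
rewrite vuE in k2; move: k1 k2.
move: (g _) (g _) (g _) (g _) => a b c d.
move: (dd u v) (dd v u) => p q k1 k2.
have : `|p - q| * (h * h) <= e * (h * h); last by rewrite ler_pM2r.
rewrite -[in leLHS](ger0_norm (ltW hh0)) -normrM mulrBl !mulrA.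
move: k1 k2; rewrite !ler_norml => /andP[k1 k1'] /andP[k2 k2']; apply/andP.
split; lra.
Unshelve. all: by end_near. Qed.

(** * Differentiation along vector fields *)

Lemma near_eq_differentiable (R : realType) (V W : normedModType R)
    (f g : V -> W) (x : V) : (\forall z \near x, f z = g z) ->
  differentiable f x -> differentiable g x.
Proof.
move=> fg df; have [cd /eqaddoP fo] := (diff_locallyP x f).1 df.
have go : g \o shift x = cst (g x) + 'd f x +o_ (0 : V) id.
  apply/eqaddoP => e e0; have := fo e e0.
  have fg0 : \forall h \near (0 : V), f (h + x) = g (h + x).
    by move: fg; rewrite (near_shift 0 x) subr0.
  apply: filterS2 fg0 => h /= ghE; rewrite -(nbhs_singleton fg).
  by rewrite !fctE /= ghE.
apply/diff_locallyP; rewrite (diff_unique cd go); split=> //.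
Qed.

Lemma is_derive_row (R : realType) (V : normedModType R) (n : nat)
    (f : V -> 'rV[R]_n) (x u : V) (df : 'rV[R]_n) :
  (forall j, is_derive x u (fun z => f z 0 j) (df 0 j)) -> is_derive x u f df.
Proof.
move=> fd; have fder : derivable f x u.
  by apply/derivable_mxP => i j; rewrite ord1; case: (fd j).
apply: DeriveDef => //; apply/rowP => j; rewrite derive_coord//.
by case: (fd j).
Qed.

Lemma is_derive_coord (R : realType) (V : normedModType R) (n : nat)
    (f : V -> 'rV[R]_n) (x u : V) (df : 'rV[R]_n) j :
  is_derive x u f df -> is_derive x u (fun z => f z 0 j) (df 0 j).
Proof.
move=> [fd <-]; rewrite derive_coord//; apply: derivableP.
by move/derivable_mxP : fd; apply.
Qed.

Lemma is_derive_scale (R : realType) (V : normedModType R) (n : nat)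
    (k : V -> R) (f : V -> 'rV[R]_n) (x u : V) (dk : R) (df : 'rV[R]_n) :
  is_derive x u k dk -> is_derive x u f df ->
  is_derive x u (fun z => k z *: f z) (dk *: f x + k x *: df).
Proof.
move=> kd fd; apply: is_derive_row => j.
have -> : (fun z => (k z *: f z) 0 j) = k * (fun z => f z 0 j).
  by apply/funext => z; rewrite mxE.
apply: is_derive_eq; first exact: (is_deriveM kd (is_derive_coord j fd)).
by rewrite !mxE addrC [dk * _]mulrC.
Qed.

Lemma differentiable_scale (R : realType) (V : normedModType R) (n : nat)
    (k : V -> R) (f : V -> 'rV[R]_n) (x : V) :
  differentiable k x -> differentiable f x ->
  differentiable (fun z => k z *: f z) x.
Proof.
move=> dk df; apply: differentiable_row => j.
have -> : (fun z => (k z *: f z) 0 j) = k * (fun z => f z 0 j).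
  by apply/funext => z; rewrite mxE.
by apply: differentiableM => //; exact: differentiable_row_coord.
Qed.

Section derive_along_field.
Variables (R : realType) (n m : nat) (A : set 'rV[R]_n).
Variables (f : 'rV[R]_n -> 'rV[R]_m) (X : 'rV[R]_n -> 'rV[R]_n) (x : 'rV[R]_n).
Hypotheses (oA : open A) (Cf : Ck 2 A f) (Ax : A x) (dX : differentiable X x).

Let fE : \forall z \near x,
  (\sum_(j < n) (fun z => X z 0 j *: 'D_(delta_mx 0 j) f z)) z = 'D_(X z) f z.
Proof.
near=> z; rewrite derive_row_sum ?fct_sumE//.
by apply: (Ck_differentiable Cf); near: z; exact: open_nbhs_nbhs.
Unshelve. all: by end_near. Qed.

Let dDf v : differentiable ('D_v f) x.
Proof. by case: Cf => _ /(_ v)[d _]; exact: d. Qed.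

Lemma differentiable_along_field : differentiable (fun z => 'D_(X z) f z) x.
Proof.
apply: near_eq_differentiable fE _; apply: differentiable_sum => j.
by apply: differentiable_scale; [exact: differentiable_row_coord | exact: dDf].
Qed.

(** The product rule for [x |-> Df(x) X(x)]. *)
Lemma derive_along_field (u : 'rV[R]_n) :
  'D_u (fun z => 'D_(X z) f z) x = 'D_('D_u X x) f x + 'D_u ('D_(X x) f) x.
Proof.
have dXu : is_derive x u X ('D_u X x) by exact/derivableP/diff_derivable.
pose e j : 'rV[R]_n := delta_mx 0 j.
have dE j := is_derive_scale (is_derive_coord j dXu)
  (derivableP (diff_derivable (v := u) (dDf (e j)))).
rewrite -(near_eq_derive u fE); have [_ ->] := is_derive_sum dE.
rewrite big_split /=.
rewrite -derive_row_sum; last by case: Cf => df _; exact: df.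
congr (_ + _).
have Ef : \forall z \near x,
    (\sum_(j < n) (fun z => X x 0 j *: 'D_(e j) f z)) z = 'D_(X x) f z.
  near=> z; rewrite derive_row_sum ?fct_sumE//.
  by apply: (Ck_differentiable Cf); near: z; exact: open_nbhs_nbhs.
have dE' j := is_deriveZ (X x 0 j) (derivableP (diff_derivable (v := u) (dDf (e j)))).
by rewrite -(near_eq_derive u Ef); have [_ ->] := is_derive_sum dE'.
Unshelve. all: by end_near. Qed.
End derive_along_field.

(** A bound [|D_(y_j) E| <= C |E|] for fields [y_j] that form the standard
    basis at [x0] gives [|DE| <= C' |E|] near [x0]: there the error made by
    replacing [y_j] with its value at [x0] is absorbed by the left-hand side.
    Then [E] vanishes along every short segment issued from [x0]. *)
Lemma locally_zero (R : realType) (n m : nat) (E : 'rV[R]_n -> 'rV[R]_m)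
    (y : 'I_n -> 'rV[R]_n -> 'rV[R]_n) (x0 : 'rV[R]_n) (C : R) : 0 <= C ->
  (\forall x \near x0, differentiable E x) ->
  (forall j, {for x0, continuous (y j)}) ->
  (forall j, y j x0 = delta_mx 0 j) ->
  (forall j, \forall x \near x0, `|'D_(y j x) E x| <= C * `|E x|) ->
  E x0 = 0 -> \forall x \near x0, E x = 0.
Proof.
move=> C0 dE cy y0 yE E0.
pose S x := \sum_(j < n) `|'D_(delta_mx 0 j) E x|.
have S0 x : 0 <= S x by apply: sumr_ge0.
have DS x v : differentiable E x -> `|'D_v E x| <= `|v| * S x.
  move=> dEx; rewrite derive_row_sum// (le_trans (ler_norm_sum _ _ _))// mulr_sumr.
  by apply: ler_sum => j _; rewrite normrZ ler_wpM2r// ler_coord.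
pose K := 2 * n%:R * C.
have K0 : 0 <= K by rewrite !mulr_ge0.
have yn : \forall x \near x0, forall j : 'I_n, `|delta_mx 0 j - y j x| <= (2 * n%:R)^-1.
  suff h (j : 'I_n) : \forall x \near x0, `|delta_mx 0 j - y j x| <= (2 * n%:R)^-1.
    exact: (filter_forall _ h).
  rewrite -(y0 j); have n0 : 0 < (2 * n%:R : R)^-1.
    by rewrite invr_gt0 mulr_gt0// ltr0n (leq_ltn_trans _ (ltn_ord j)).
  by move/cvgrPdist_le : (cy j) => /(_ _ n0).
have SK : \forall x \near x0, S x <= K * `|E x|.
  near=> x.
  have dEx : differentiable E x by near: x.
  (* Split [delta_mx 0 j] as [y j x] plus a remainder that is small near [x0]. *)
  have Dj (j : 'I_n) : `|'D_(delta_mx 0 j) E x| <= C * `|E x| + (2 * n%:R)^-1 * S x.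
    have -> : (delta_mx 0 j : 'rV[R]_n) = y j x + (delta_mx 0 j - y j x).
      by rewrite addrC subrK.
    rewrite deriveD_dir// (le_trans (ler_normD _ _))// lerD//.
      by move: j; near: x; exact: filter_forall.
    by rewrite (le_trans (DS _ _ dEx))// ler_wpM2r//; move: j; near: x.
  have : S x <= n%:R * C * `|E x| + 1 / 2 * S x.
    rewrite {1}/S (le_trans (ler_sum _ (fun j _ => Dj j)))//.
    rewrite sumr_const card_ord -[leLHS]mulr_natl mulrDr mulrA lerD//.
    have [->|n0] := eqVneq n 0%N; first by rewrite mul0r mulr_ge0.
    by rewrite mulrA ler_wpM2r// invfM mulrCA mulfV ?pnatr_eq0// mulr1 div1r.
  rewrite /K -[2 * n%:R * C]mulrA -[2 * _ * `|_|]mulrA.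
  by move: (_ * `|E x|) (S x) => a b; lra.
have : \forall x \near x0, differentiable E x /\ S x <= K * `|E x|.
  exact: filterI.
move=> /nbhs_ballP[r r0 rE].
near=> z; set u := z - x0.
have inr t : 0 <= t <= 1 -> ball x0 r (x0 + t *: u).
  by move=> t01; apply: ball_segment => //; [exact: ballxx|near: z; exact: nbhsx_ballx].
have dEu (t : R) : 0 <= t <= 1 ->
    is_derive t 1 (fun s => E (x0 + s *: u)) ('D_u E (x0 + t *: u)).
  by move=> t01; apply: is_derive_line; have [] := rE _ (inr _ t01).
have := @gronwall_short R m (fun s : R => E (x0 + s *: u)) 0 1 (`|u| * K).
rewrite subr0 mulr1 scale0r addr0 => /(_ _ _ _ E0 _ 1).
rewrite scale1r addrC subrK; apply => //.
- by rewrite mulr_ge0.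
- rewrite distrC; near: z.
  have : \forall z \near x0, `|x0 - z| <= (2 * (K + 1))^-1.
    apply/nbhs_ballP; exists (2 * (K + 1))^-1.
      by rewrite /= invr_gt0 mulr_gt0// ltr_wpDl.
    by move=> z; rewrite -ball_normE => /ltW.
  apply: filterS => z zK; apply: (@le_trans _ _ ((2 * (K + 1))^-1 * K)).
    by rewrite ler_wpM2r.
  by rewrite invfM -mulrA div1r ler_piMr// ?invr_ge0// mulrC ler_pdivrMr
    ?ltr_wpDl// mul1r lerDl.
- apply: derivable_within_continuous => t; rewrite in_itv /= => t01.
  by case: (dEu _ t01).
- move=> t /andP[t0 t1]; have t01 : 0 <= t <= 1 by rewrite !ltW.
  exists ('D_u E (x0 + t *: u)); first exact: dEu.
  have [dEt SKt] := rE _ (inr _ t01).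
  by rewrite -mulrA (le_trans (DS _ _ dEt))// ler_wpM2l.
- by rewrite ler01 lexx.
Unshelve. all: by end_near. Qed.

(** * Picard iteration *)

Lemma antiderivative_real (R : realType) (h : R -> R) : continuous h ->
  exists H : R -> R, H 0 = 0 /\ forall t : R, -1 < t < 1 -> is_derive t 1 H (h t).
Proof.
move=> ch; pose mu := @lebesgue_measure R.
pose I t := (\int[mu]_(s in [set` `[-1, t]]) h s)%R.
exists (fun t => I t - I 0); split=> [|t /andP[t0 t1]]; first by rewrite subrr.
have ih : mu.-integrable `[-1, 1] (EFin \o h).
  apply: continuous_compact_integrable; first exact: segment_compact.
  exact: continuous_subspaceT.
have [dI IE] := continuous_FTC1_closed t1 ih t0 (ch t).
have It : is_derive t 1 I (h t) 
  by apply: DeriveDef; [exact: dI|rewrite -derive1E; exact: IE].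
by have := is_deriveB It (is_derive_cst (I 0) t 1); rewrite subr0.
Qed.

Lemma antiderivative (R : realType) (n : nat) (h : R -> 'rV[R]_n) : continuous h ->
  exists H : R -> 'rV[R]_n,
    H 0 = 0 /\ forall t : R, -1 < t < 1 -> is_derive t 1 H (h t).
Proof.
move=> ch; have ex j : exists H : R -> R,
    H 0 = 0 /\ forall t : R, -1 < t < 1 -> is_derive t 1 H (h t 0 j).
  apply: antiderivative_real => t.
  apply: (@continuous_comp _ _ _ h (fun M : 'rV[R]_n => M 0 j)); first exact: ch.
  exact: coord_continuous.
have [H HP] := choice ex; exists (fun t => \row_j H j t); split=> [|t t1].
  by apply/rowP => j; rewrite !mxE; have [] := HP j.
apply: is_derive_row => j; have [_ /(_ t t1)] := HP j.
by under eq_fun do rewrite mxE.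
Qed.

(** [0] is the midpoint of the interval because initial values are taken there. *)
Lemma MVT_sym (R : realType) (n : nat) (f : R -> 'rV[R]_n) (e K t : R) : 0 <= K ->
  continuous f -> (forall t : R, -e < t < e -> exists2 v, is_derive t 1 f v & `|v| <= K) ->
  -e <= t <= e -> `|f t - f 0| <= K * e.
Proof.
move=> K0 cf df /andP[te et]; have e0 : 0 <= e by lra.
have [t0|t0] := leP 0 t.
  apply: (@le_trans _ _ (K * (t - 0))); last by rewrite subr0 ler_wpM2l.
  apply: MVT_le => //; first exact: continuous_subspaceT.
  by move=> s /andP[s0 st]; apply: df; apply/andP; split; lra.
rewrite distrC; apply: (@le_trans _ _ (K * (0 - t))).
  apply: MVT_le; rewrite ?(ltW t0)//; first exact: continuous_subspaceT.
  by move=> s /andP[s0 st]; apply: df; apply/andP; split; lra.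
by rewrite ler_wpM2l// sub0r lerNl.
Qed.

(** The iterates of the Picard operator [u |-> x + \int_0^t f (u s) ds] on
    [-e, e], continued by constants outside that interval, form a geometric
    Cauchy sequence because [L * e <= 1 / 2]. *)
Lemma picard (R : realType) (n : nat) (f : 'rV[R]_n -> 'rV[R]_n) (L e : R)
    (x : 'rV[R]_n) : 0 <= L -> (forall y z, `|f z - f y| <= L * `|z - y|) ->
  0 < e < 1 -> L * e <= 1 / 2 ->
  exists u : R -> 'rV[R]_n,
    [/\ continuous u, u 0 = x &
        forall t : R, -e < t < e -> is_derive t 1 u (f (u t))].
Proof.
move=> L0 fL /andP[e0 e1] Le; pose clamp (t : R) := Num.max (-e) (Num.min t e).
have clampe t : -e <= clamp t <= e.
  by rewrite /clamp le_max lexx /= ge_max ge_min lexx orbT andbT; lra.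
have clampK (t : R) : -e <= t <= e -> clamp t = t.
  by move=> /andP[t0 t1]; rewrite /clamp (min_idPl t1); exact/max_idPr.
have cclamp : continuous clamp.
  move=> t; apply: (@continuous_max _ _ (fun=> -e) (fun s => Num.min s e) t).
    exact: cvg_cst.
  apply: (@continuous_min _ _ id (fun=> e) t); [exact: cvg_id|exact: cvg_cst].
have cf : continuous f.
  move=> y; apply/(@cvgrPdist_le _ _ _ (nbhs y)) => d d0.
  apply/nbhs_ballP; exists (d / (L + 1)); first by rewrite /= divr_gt0// ltr_wpDl.
  move=> z; rewrite -ball_normE /= => /ltW yz; rewrite (le_trans (fL _ _))//.
  apply: (@le_trans _ _ (L * (d / (L + 1)))); first by rewrite ler_wpM2l.
  rewrite mulrC -mulrA ler_piMr// ?(ltW d0)// mulrC ler_pdivrMr ?ltr_wpDl//.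
  by rewrite mul1r lerDl.
(* [v] is the image of [u] under the Picard operator. *)
have step (u : R -> 'rV[R]_n) : exists v : R -> 'rV[R]_n, continuous u ->
    [/\ continuous v, v 0 = x, forall t, v t = v (clamp t) &
        forall t : R, -e < t < e -> is_derive t 1 v (f (u t))].
  have [cu|] := pselect (continuous u); last by exists u.
  have [|H [H0 dH]] := @antiderivative _ _ (fun t => f (u t)).
    by move=> t; apply: continuous_comp; [exact: cu|exact: cf].
  exists (fun t => x + H (clamp t)) => _; split.
  - move=> t; apply: continuousD; first exact: cvg_cst.
    apply: continuous_comp; first exact: cclamp.
    have ct : -1 < clamp t < 1 by have := clampe t; move=> /andP[? ?]; apply/andP; split; lra.
    by apply/differentiable_continuous/derivable1_diffP; case: (dH _ ct).
  - by rewrite clampK ?H0 ?addr0//; apply/andP; split; lra.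
  - by move=> t; rewrite [clamp (clamp t)]clampK.
  - move=> t te; have t1 : -1 < t < 1 by move: te => /andP[? ?]; apply/andP; split; lra.
    apply: (@near_eq_is_derive _ _ _ (fun s => x + H s)).
      have : \forall s \near t, -e < s < e by exact: near_itv.
      by apply: filterS => s /andP[? ?]; rewrite clampK// !ltW.
    by have := is_deriveD (is_derive_cst x t 1) (dH t t1); rewrite add0r.
have [T TP] := choice step; pose U k := iter k T (fun _ => x).
have cU k : continuous (U k).
  by elim: k => [|k ih]; [exact: cst_continuous|have [] := TP _ ih].
have U0 k : U k 0 = x by case: k => // k; have [] := TP _ (cU k).
have Uclamp k t : U k t = U k (clamp t) 
  by case: k => // k; have [_ _ c _] := TP _ (cU k); exact: c.
have dU k (t : R) : -e < t < e -> is_derive t 1 (U k.+1) (f (U k t)).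
  by have [_ _ _ d] := TP _ (cU k); exact: d.
have [M [M0 fM]] : exists M, 0 <= M /\ `|f x| * e <= M.
  by exists (`|f x| * e); rewrite mulr_ge0// ltW.
have h0 k : 0 <= (1 / 2 : R) ^+ k by rewrite exprn_ge0.
have dist1 k t : `|U k.+1 t - U k t| <= M * (1 / 2) ^+ k.
  elim: k t => [|k ih] t.
    rewrite expr0 mulr1 Uclamp [U 0%N _]/= -[X in _ - X](U0 1%N).
    apply: le_trans fM; apply: MVT_sym => // s se.
    by exists (f (U 0%N s)) => //; exact: dU.
  rewrite Uclamp [U k.+1 t]Uclamp.
  have -> : U k.+2 (clamp t) - U k.+1 (clamp t) =
      (U k.+2 - U k.+1) (clamp t) - (U k.+2 - U k.+1) 0.
    by rewrite !fctE !U0 subrr subr0.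
  apply: (@le_trans _ _ (L * (M * (1 / 2) ^+ k) * e)).
    apply: MVT_sym => //.
    - by rewrite mulr_ge0// mulr_ge0.
    - by move=> s; apply: continuousB; exact: cU.
    - move=> s se; exists (f (U k.+1 s) - f (U k s)).
        by apply: is_deriveB; exact: dU.
      by rewrite (le_trans (fL _ _))// ler_wpM2l.
  have -> : L * (M * (1 / 2) ^+ k) * e = M * (1 / 2) ^+ k * (L * e) by ring.
  by rewrite exprSr [M * (_ * (1 / 2))]mulrA ler_wpM2l// mulr_ge0.
have dist k p t : `|U (k + p)%N t - U k t| <= 2 * M * (1 / 2) ^+ k.
  suff : `|U (k + p)%N t - U k t| <= 2 * M * ((1 / 2) ^+ k - (1 / 2) ^+ (k + p)).
    by move=> /le_trans; apply; rewrite ler_wpM2l ?mulr_ge0// gerBl.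
  elim: p => [|p ih]; first by rewrite addn0 !subrr normr0 mulr0.
  have := dist1 (k + p)%N t; rewrite addnS exprS => d1.
  rewrite -(subrKA (U (k + p)%N t)) (le_trans (ler_normD _ _))//.
  have := lerD d1 ih; move: (_ ^+ (k + p)) (_ ^+ k) => a b; lra.
have half0 : (fun k => 2 * M * (1 / 2) ^+ k) @ \oo --> (0 : R).
  by apply: cvg_geometric; rewrite ger0_norm; lra.
have halfe (d : R) : 0 < d -> \forall k \near \oo, 2 * M * (1 / 2) ^+ k < d.
  by move=> d0; apply: (cvgr_lt 0 half0).
have cvU t : cvg (U ^~ t @ \oo).
  apply/cauchy_cvgP/cauchy_exP => d d0.
  have [k _ kd] := halfe d d0; exists (U k t); exists k => // p /= kp.
  rewrite -ball_normE /= distrC -(subnKC kp).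
  by apply: le_lt_trans (dist _ _ _) _; apply: kd => /=.
pose u t := lim (U ^~ t @ \oo).
have uU k t : `|u t - U k t| <= 2 * M * (1 / 2) ^+ k.
  have : (fun p => `|U p t - U k t|) @ \oo --> `|u t - U k t|.
    by apply: cvg_norm; apply: cvgB; [exact: cvU|exact: cvg_cst].
  move=> /cvgr_to_le; apply; exists k => // p /= kp.
  by rewrite -(subnKC kp).
have cu : continuous u.
  move=> t; apply/(@cvgrPdist_le _ _ _ (nbhs t)) => d d0.
  have [k _ /(_ k (leqnn k)) /= kd] := halfe _ (divr_gt0 d0 (ltr0n R 3)).
  have d3 : 0 < d / 3 by rewrite divr_gt0.
  have : \forall s \near t, `|U k t - U k s| <= d / 3.
    by move/(@cvgrPdist_le _ _ _ (nbhs t)) : (cU k t); exact.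
  apply: filterS => s ts.
  have := uU k t; have := uU k s; rewrite [`|u s - _|]distrC => us ut.
  rewrite -(subrKA (U k t)) -[X in _ + X](subrKA (U k s)).
  rewrite (le_trans (ler_normD _ _))//.
  have := ler_normD (U k t - U k s) (U k s - u s); lra.
have [cv v0 _ dv] := TP _ cu.
have vu t : -e < t < e -> T u t = u t.
  move=> te; apply/eqP; rewrite -subr_eq0 -normr_le0; apply/ler_addgt0Pr => d d0.
  rewrite add0r; have [k _ /(_ k (leqnn k)) /= kd] := halfe _ (divr_gt0 d0 (ltr0n R 2)).
  have Tk : `|T u t - U k.+1 t| <= 2 * M * (1 / 2) ^+ k.
    have -> : T u t - U k.+1 t = (T u - U k.+1) t - (T u - U k.+1) 0.
      by rewrite !fctE v0 U0 subrr subr0.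
    apply: (@le_trans _ _ (L * (2 * M * (1 / 2) ^+ k) * e)).
      apply: MVT_sym => //.
      - by rewrite mulr_ge0// !mulr_ge0.
      - by move=> s; apply: continuousB; [exact: cv|exact: cU].
      - move=> s se; exists (f (u s) - f (U k s)).
          by apply: is_deriveB; [exact: dv|exact: dU].
        by rewrite (le_trans (fL _ _))// ler_wpM2l.
      - by move: te => /andP[t0 t1]; rewrite !ltW.
    have -> : L * (2 * M * (1 / 2) ^+ k) * e = 2 * M * (1 / 2) ^+ k * (L * e) by ring.
    by rewrite ler_piMr ?mulr_ge0//; lra.
  have := uU k.+1 t; rewrite distrC exprS => uk.
  rewrite -(subrKA (U k.+1 t)) (le_trans (ler_normD _ _))//.
  have : 0 <= M * (1 / 2) ^+ k by rewrite mulr_ge0.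
  move: uk Tk kd; move: ((1 / 2) ^+ k) => q; lra.
exists u; split=> [//||t te]; first by rewrite -vu ?v0//; apply/andP; split; lra.
apply: (@near_eq_is_derive _ _ _ (T u)); last exact: dv.
have : \forall s \near t, -e < s < e by exact: near_itv.
by apply: filterS => s; exact: vu.
Qed.

(** * Vector fields and velocities on manifolds *)

(** [gronwall_short] after reversal of time. *)
Lemma gronwall_short_left (R : realType) (n : nat) (f : R -> 'rV[R]_n) (a b L : R) :
  0 <= L -> L * (b - a) <= 1 / 2 ->
  (forall t, a <= t <= b -> {for t, continuous f}) -> f b = 0 ->
  (forall t, a < t < b -> exists2 v, is_derive t 1 f v & `|v| <= L * `|f t|) ->
  forall t, a <= t <= b -> f t = 0.
Proof.
move=> L0 Lab cf fb df t /andP[at_ tb].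
have tN : - b <= - t <= - a by rewrite !lerN2 tb.
rewrite -[t]opprK; apply: (@gronwall_short R n (fun s => f (- s)) (- b) (- a) L) tN => //.
- by rewrite opprK addrC.
- apply: differentiable_within => s; rewrite /= in_itv /= => /andP[bs sa].
  apply: (@continuous_comp _ _ _ -%R f); first exact: opp_continuous.
  by apply: cf; rewrite lerNr sa lerNl.
- by rewrite opprK.
- move=> s /andP[bs sa]; have [|v fv vL] := df (- s).
    by rewrite ltrNr sa ltrNl.
  exists (- v); last by rewrite normrN.
  have dN : is_derive s 1 (-%R : R -> R) (-1) by exact: is_deriveNid.
  have dfs : differentiable f (- s) by apply/derivable1_diffP; case: fv.
  have := is_derive_chain dN dfs; rewrite deriveE// linearN.
  by rewrite -deriveE//; case: fv => _ ->.
Qed.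

Definition compat_vfield (R : realType) (d : nat) (M : smoothManifoldType R d)
    (F : vfield M) : Prop :=
  forall i j p, chart_dom (atlas i) p -> chart_dom (atlas j) p ->
    F j p = tangent_map id i j p (F i p).

(** Jointly in two points close to [x], so that finitely many such conditions
    intersect as neighborhoods. *)
Definition locally_lipschitz (R : realType) (n m : nat)
    (f : 'rV[R]_n -> 'rV[R]_m) (x : 'rV[R]_n) : Prop :=
  exists2 L : R, 0 <= L &
    \forall yz \near (x, x), `|f yz.2 - f yz.1| <= L * `|yz.2 - yz.1|.

(** What uniqueness and local existence of integral curves use of a smooth field;
    it passes at once to linear combinations. *)
Definition lip_vfield (R : realType) (d : nat) (M : smoothManifoldType R d)
    (F : vfield M) : Prop :=
  compat_vfield F /\ forall i p, chart_dom (atlas i) p ->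
    locally_lipschitz (F i \o chart_inv (atlas i)) (atlas i p).

Section vfields.
Variables (R : realType) (d : nat) (M : smoothManifoldType R d).
Implicit Types (F H : vfield M) (i j : atlas_index M) (p : M).

Lemma chart_img_nbhs i p : chart_dom (atlas i) p ->
  nbhs (atlas i p) (chart_img (atlas i)).
Proof. by move=> ip; apply: open_nbhs_nbhs; split; [exact: chart_img_open|exists p]. Qed.

Lemma chart_dom_nbhs i p : chart_dom (atlas i) p -> nbhs p (chart_dom (atlas i)).
Proof. by move=> ip; apply: open_nbhs_nbhs; split; [exact: chart_dom_open|]. Qed.

Lemma chart_inv_at i p : chart_dom (atlas i) p ->
  {for atlas i p, continuous (chart_inv (atlas i))}.
Proof. by move=> ip; apply: chart_inv_continuous; exists p. Qed.

Lemma smooth_lip F : smooth_vfield F -> lip_vfield F.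
Proof.
move=> [Fc Fs]; split=> // i p ip.
have [] := @Ck1_lipschitz _ _ _ (chart_img (atlas i)) (F i \o chart_inv (atlas i)) (atlas i p).
- exact: chart_img_open.
- exact: Fs.
- by exists p.
move=> r [L [r0 L0 _ FL]]; exists L => //; exists (ball (atlas i p) r, ball (atlas i p) r).
  by split; exact: nbhsx_ballx.
by move=> [y z] /= [yr zr]; exact: FL.
Qed.

Lemma transition_differentiable i j p :
  chart_dom (atlas i) p -> chart_dom (atlas j) p ->
  differentiable (fun x => atlas j (chart_inv (atlas i) x)) (atlas i p).
Proof.
move=> ip jp; have := @atlas_compatible R d M i j 1%N.
by case=> + _; apply; exists p.
Qed.

Lemma lip_system (m : nat) (F : 'I_m.+1 -> vfield M) (u : 'rV[R]_m) :
  (forall k, lip_vfield (F k)) -> lip_vfield (system_field F u).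
Proof.
move=> lF; split=> [i j p ip jp|i p ip].
  have dt := transition_differentiable ip jp.
  rewrite /system_field /tangent_map /= deriveD_dir// ![in RHS]deriveE//.
  rewrite linear_sum; congr (_ + _).
    by rewrite -deriveE//; have [Fc _] := lF ord0; exact: Fc.
  apply: eq_bigr => k _; rewrite linearZ -deriveE//; congr (_ *: _).
  by have [Fc _] := lF (lift ord0 k); exact: Fc.
have ex k : exists L : R, 0 <= L /\ \forall yz \near (atlas i p, atlas i p),
    `|F k i (chart_inv (atlas i) yz.2) - F k i (chart_inv (atlas i) yz.1)|
      <= L * `|yz.2 - yz.1|.
  by have [_ /(_ i p ip)[L]] := lF k; exists L.
have [L LP] := choice ex.
exists (L ord0 + \sum_(j < m) `|u 0 j| * L (lift ord0 j)).
  rewrite addr_ge0//; first by have [] := LP ord0.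
  by apply: sumr_ge0 => j _; rewrite mulr_ge0//; have [] := LP (lift ord0 j).
have : \forall yz \near (atlas i p, atlas i p), forall k : 'I_m.+1,
    `|F k i (chart_inv (atlas i) yz.2) - F k i (chart_inv (atlas i) yz.1)|
      <= L k * `|yz.2 - yz.1|.
  exact: (filter_forall _ (fun k => (LP k).2)).
apply: filterS => -[y z] /= yzL.
rewrite /system_field /= opprD addrACA (le_trans (ler_normD _ _))// mulrDl lerD//.
rewrite -sumrB (le_trans (ler_norm_sum _ _ _))// mulr_suml ler_sum// => j _.
by rewrite -scalerBr normrZ -mulrA ler_wpM2l.
Qed.

Lemma near_has_velocity F (c c' : R -> M) (t : R) :
  (\forall s \near t, c s = c' s) -> has_velocity F c t -> has_velocity F c' t.
Proof.
move=> cc' [ct dc]; have ct' := nbhs_singleton cc'; split.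
  rewrite /prop_for /continuous_at -ct'; apply: cvg_trans ct.
  exact: near_eq_cvg.
move=> i; rewrite -ct' => ip; have := dc i ip; apply: near_eq_is_derive.
by apply: filterS cc' => s ->.
Qed.

(** In another chart [j] the curve is, near [t], its image in the chart [i]
    followed by the transition map. *)
Lemma has_velocity_chart F (c : R -> M) (t : R) i : compat_vfield F ->
  {for t, continuous c} -> chart_dom (atlas i) (c t) ->
  is_derive t 1 (fun s => atlas i (c s)) (F i (c t)) -> has_velocity F c t.
Proof.
move=> Fc ct it dc; split=> // j jt.
have dt := transition_differentiable it jt.
rewrite (Fc i j)//.
apply: (@near_eq_is_derive _ _ _ (fun s => atlas j (chart_inv (atlas i) (atlas i (c s))))).
  have : \forall s \near t, chart_dom (atlas i) (c s) by exact/ct/chart_dom_nbhs.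
  by apply: filterS => s is_; rewrite chart_mapK.
exact: (is_derive_chain dc dt).
Qed.

End vfields.

(** * Uniqueness of curves with a prescribed velocity *)

Section uniqueness.
Variables (R : realType) (d : nat) (M : smoothManifoldType R d).
Implicit Types (F H : vfield M) (c : R -> M).

Lemma chart_agree F c c' (i : atlas_index M) (a b L : R) :
  0 <= L -> L * (b - a) <= 1 / 2 -> a <= b ->
  (forall t, a <= t <= b ->
    [/\ {for t, continuous c}, {for t, continuous c'},
        chart_dom (atlas i) (c t), chart_dom (atlas i) (c' t) &
        `|F i (c t) - F i (c' t)| <= L * `|atlas i (c t) - atlas i (c' t)|]) ->
  (forall t, a < t < b -> has_velocity F c t /\ has_velocity F c' t) ->
  c a = c' a \/ c b = c' b ->
  forall t, a <= t <= b -> c t = c' t.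
Proof.
move=> L0 Lab ab cc' dcc' cab t tab.
pose f s := atlas i (c s) - atlas i (c' s).
suff : f t = 0.
  move=> /eqP; rewrite subr_eq0 => /eqP ft; have [_ _ it it' _] := cc' t tab.
  by rewrite -[c t](chart_mapK it) ft chart_mapK.
have cf s : a <= s <= b -> {for s, continuous f}.
  move=> sab; have [cs cs' is_ is' _] := cc' s sab; apply: continuousB.
    by apply: continuous_comp; [exact: cs|exact: chart_map_continuous].
  by apply: continuous_comp; [exact: cs'|exact: chart_map_continuous].
have df s : a < s < b -> exists2 v, is_derive s 1 f v & `|v| <= L * `|f s|.
  move=> sab; have sab' : a <= s <= b by move: sab => /andP[? ?]; rewrite !ltW.
  have [_ _ is_ is' fs] := cc' s sab'.
  have [[_ dc] [_ dc']] := dcc' s sab.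
  by exists (F i (c s) - F i (c' s)) => //; apply: is_deriveB; [exact: dc|exact: dc'].
case: cab => e.
  apply: (@gronwall_short R d f a b L) => //; last by rewrite /f e subrr.
  by apply: differentiable_within => s; rewrite /= in_itv /=; exact: cf.
by apply: (@gronwall_short_left R d f a b L) => //; rewrite /f e subrr.
Qed.

(** Near a common value both curves stay where [F] is Lipschitz in a chart. *)
Lemma near_chart_agree F c c' (t0 : R) : lip_vfield F ->
  {for t0, continuous c} -> {for t0, continuous c'} -> c t0 = c' t0 ->
  exists i L, 0 <= L /\ \forall t \near t0,
    [/\ chart_dom (atlas i) (c t), chart_dom (atlas i) (c' t) &
        `|F i (c t) - F i (c' t)| <= L * `|atlas i (c t) - atlas i (c' t)|].
Proof.
move=> [_ lF] ct ct' cc'; have [i it] := atlas_cover (c t0).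
have it' : chart_dom (atlas i) (c' t0) by rewrite -cc'.
have [L L0 [[A B] /= [nA nB] AB]] := lF i _ it; exists i, L; split=> //.
have nc : \forall t \near t0, chart_dom (atlas i) (c t) by exact/ct/chart_dom_nbhs.
have nc' : \forall t \near t0, chart_dom (atlas i) (c' t) by exact/ct'/chart_dom_nbhs.
have nAt : \forall t \near t0, A (atlas i (c' t)).
  by rewrite cc' in nA; exact: (continuous_comp ct' (chart_map_continuous it')).
have nBt : \forall t \near t0, B (atlas i (c t)).
  exact: (continuous_comp ct (chart_map_continuous it)).
near=> t; have jt : chart_dom (atlas i) (c t) by near: t.
have jt' : chart_dom (atlas i) (c' t) by near: t.
split=> //; have := AB (atlas i (c' t), atlas i (c t)).
rewrite /= !chart_mapK//; apply; split; [by near: t|by near: t].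
Unshelve. all: by end_near. Qed.

(** The set of times at which the two curves agree is closed because [M] is
    Hausdorff, and open by the local estimate. The velocity may jump: at each
    time the two curves follow a common field before it and another after it. *)
Lemma curve_unique c c' (A : set R) (t1 : R) : is_interval A ->
  (forall t, A t -> {for t, continuous c} /\ {for t, continuous c'}) ->
  (forall t, A t -> exists e Fl Fr, [/\ 0 < e, lip_vfield Fl, lip_vfield Fr,
     forall s, A s -> t - e < s < t -> has_velocity Fl c s /\ has_velocity Fl c' s &
     forall s, A s -> t < s < t + e -> has_velocity Fr c s /\ has_velocity Fr c' s]) ->
  A t1 -> c t1 = c' t1 -> forall t, A t -> c t = c' t.
Proof.
move=> iA cc' vel At1 e1.
have open_agree t0 : A t0 -> c t0 = c' t0 -> \forall t \near t0, A t -> c t = c' t.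
  move=> At0 e0; have [ct ct'] := cc' _ At0.
  have [e [Fl [Fr [e_gt0 lFl lFr vl vr]]]] := vel _ At0.
  have [il [Ll [Ll0 nl]]] := near_chart_agree lFl ct ct' e0.
  have [ir [Lr [Lr0 nr]]] := near_chart_agree lFr ct ct' e0.
  have {nl nr} : \forall t \near t0, 
    [/\ chart_dom (atlas il) (c t), chart_dom (atlas il) (c' t) &
        `|Fl il (c t) - Fl il (c' t)| <= Ll * `|atlas il (c t) - atlas il (c' t)|] /\
    [/\ chart_dom (atlas ir) (c t), chart_dom (atlas ir) (c' t) &
        `|Fr ir (c t) - Fr ir (c' t)| <= Lr * `|atlas ir (c t) - atlas ir (c' t)|].
    exact: filterI.
  move=> /nbhs_ballP[r /= r0 rP].
  have small L : 0 <= L -> exists2 q : R, 0 < q & forall t, 0 <= t < q -> L * t <= 1 / 2.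
    move=> L0; exists (1 / (2 * (L + 1))); first by rewrite divr_gt0// mulr_gt0// ltr_wpDl.
    move=> t /andP[t0' tq]; apply: (@le_trans _ _ ((L + 1) * t)); first nra.
    move: tq; rewrite ltr_pdivlMr ?mulr_gt0 ?ltr_wpDl//; lra.
  have [ql ql0 qlP] := small _ Ll0; have [qr qr0 qrP] := small _ Lr0.
  apply/nbhs_ballP; exists (Num.min (Num.min e r) (Num.min ql qr)).
    by rewrite /= !lt_min e_gt0 r0 ql0 qr0.
  move=> t; rewrite -ball_normE /= !lt_min => /andP[/andP[te tr] /andP[tl tqr]] At.
  have inr s : `|t0 - s| <= `|t0 - t| -> ball t0 r s.
    by move=> st; rewrite -ball_normE /=; exact: le_lt_trans tr.
  have [tt0|tt0|->//] := ltgtP t t0.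
    have tt : `|t0 - t| = t0 - t by rewrite ger0_norm// subr_ge0 ltW.
    rewrite tt in te tl tqr inr.
    apply: (@chart_agree Fl c c' il t t0 Ll) => //.
    - by apply: qlP; rewrite subr_ge0 tl ltW.
    - exact: ltW.
    - move=> s tst0; have [ts st0] := andP tst0.
      have [cs cs'] := cc' s (iA _ _ At At0 _ tst0).
      have [|[j1 j2 j3] _] := rP s; last by split.
      by apply: inr; rewrite ger0_norm ?subr_ge0// lerD2l lerN2.
    - move=> s /andP[ts st0]; apply: vl; last by apply/andP; split; lra.
      by apply: (iA _ _ At At0); rewrite !ltW.
    - by right.
    - by rewrite lexx ltW.
  have tt : `|t0 - t| = t - t0 by rewrite distrC ger0_norm// subr_ge0 ltW.
  rewrite tt in te tl tqr inr.
  apply: (@chart_agree Fr c c' ir t0 t Lr) => //.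
  - by apply: qrP; rewrite subr_ge0 tqr ltW.
  - exact: ltW.
  - move=> s tst0; have [ts st0] := andP tst0.
    have [cs cs'] := cc' s (iA _ _ At0 At _ tst0).
    have [|_ [j1 j2 j3]] := rP s; last by split.
    by apply: inr; rewrite distrC ger0_norm ?subr_ge0// lerD2r.
  - move=> s /andP[ts st0]; apply: vr; last by apply/andP; split; lra.
    by apply: (iA _ _ At0 At); rewrite !ltW.
  - by left.
  - by rewrite lexx ltW.
have cA : connected A by apply/connected_intervalP.
pose B := [set t | A t /\ c t = c' t].
suff BA : B = A by move=> t; rewrite -BA => -[].
apply: cA; first by exists t1.
- exists [set t | \forall s \near t, A s -> c s = c' s].
    exact: open_interior.
  apply/seteqP; split=> [t [At ct]|t [At nt]]; first by split=> //; exact: open_agree.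
  by split=> //; exact: (nbhs_singleton nt).
- exists (closure B); first exact: closed_closure.
  apply/seteqP; split=> [t [At ct]|t [At Bt]].
    by split=> //; apply: subset_closure.
  split=> //; apply: manifold_hausdorff => U V Uc Vc.
  have [ct ct'] := cc' _ At.
  have nU : \forall s \near t, U (c s) by exact: ct.
  have nV : \forall s \near t, V (c' s) by exact: ct'.
  have [s [[As es] [Us Vs]]] := Bt _ (filterI nU nV).
  by exists (c s); split=> //; rewrite es.
Qed.
End uniqueness.

(** * Local flows *)

Lemma clamp_lipschitz (R : realType) (h a b : R) : 0 <= h ->
  `|Num.max (-h) (Num.min b h) - Num.max (-h) (Num.min a h)| <= `|b - a|.
Proof.
move=> h0; rewrite /Num.max /Num.min.
by do !case: ifPn; rewrite -?leNgt => *; rewrite ler_norml; apply/andP; split;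
  have := ler_norm (b - a); have := ler_norm (a - b); rewrite [`|a - b|]distrC; lra.
Qed.

(** Picard applies to the field composed with the retraction of the whole space
    onto a cube; its solutions stay in the cube, where the two fields agree,
    for a time that does not depend on the initial point near [p0]. *)
Lemma local_flow (R : realType) (d : nat) (M : smoothManifoldType R d)
    (F : vfield M) (p0 : M) : lip_vfield F ->
  exists2 e : R, 0 < e & \forall p \near p0, exists c : R -> M,
    c 0 = p /\ forall t, -e < t < e -> has_velocity F c t.
Proof.
move=> [Fc lF]; have [i ip0] := atlas_cover p0; pose x0 := atlas i p0.
have [L L0 [[A B] /= [nA nB] AB]] := lF i _ ip0.
pose f := F i \o chart_inv (atlas i).
have : \forall x \near x0, [/\ A x, B x & chart_img (atlas i) x].
  near=> x; split; [by near: x|by near: x|near: x; exact: chart_img_nbhs].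
move=> /nbhs_ballP[r /= r0 rP].
have fL x y : ball x0 r x -> ball x0 r y -> `|f y - f x| <= L * `|y - x|.
  by move=> /rP[Ax _ _] /rP[_ By _]; apply: (AB (x, y)).
pose h := r / 2; have h0 : 0 < h by rewrite divr_gt0.
pose cl (a : R) := Num.max (- h) (Num.min a h).
(* The retraction onto the cube of center [x0] and half-side [h]. *)
pose P (x : 'rV[R]_d) : 'rV[R]_d := x0 + \row_j cl (x 0 j - x0 0 j).
have Pball x : ball x0 r (P x).
  rewrite -ball_normE /= /P opprD addrA subrr sub0r normrN.
  apply: (@le_lt_trans _ _ h); last by rewrite /h; lra.
  apply: ler_normv => [|j]; first exact: ltW.
  rewrite mxE ler_norml /cl le_max lexx /= ge_max ge_min lexx orbT andbT; lra.
have PL x y : `|P y - P x| <= `|y - x|.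
  rewrite /P opprD addrACA subrr add0r; apply: ler_normv => // j.
  rewrite !mxE; apply: le_trans (clamp_lipschitz _ _ (ltW h0)) _.
  have -> : y 0 j - x0 0 j - (x 0 j - x0 0 j) = (y - x) 0 j by rewrite !mxE; ring.
  exact: ler_coord.
have PK x : `|x - x0| <= h -> P x = x.
  move=> xh; apply/rowP => j; rewrite !mxE /cl.
  have : `|x 0 j - x0 0 j| <= h.
    by apply: le_trans xh; have := ler_coord (x - x0) j; rewrite !mxE.
  rewrite ler_norml => /andP[a b].
  by rewrite (min_idPl b) (max_idPr a) addrC subrK.
have gL x y : `|f (P y) - f (P x)| <= L * `|y - x|.
  by apply: le_trans (fL _ _ (Pball _) (Pball _)) _; rewrite ler_wpM2l.
pose K := `|f x0| + L * r.
have K0 : 0 <= K by rewrite addr_ge0// mulr_ge0// ltW.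
have gK x : `|f (P x)| <= K.
  rewrite -[f (P x)](subrK (f x0)) (le_trans (ler_normD _ _))// addrC lerD//.
  apply: le_trans (fL _ _ (ballxx x0 r0) (Pball _)) _; rewrite ler_wpM2l//.
  by have := Pball x; rewrite -ball_normE /= distrC => /ltW.
(* The first two bounds are those of [picard]; the third keeps the solutions,
   whose speed is at most [K], in the cube. *)
pose e := Num.min (1 / 2) (Num.min (1 / (2 * (L + 1))) (r / (4 * (K + 1)))).
have e0 : 0 < e.
  by rewrite !lt_min !divr_gt0 ?mulr_gt0// ltr_wpDl.
have e1 : e <= 1 / 2 by rewrite ge_min lexx.
have Le : L * e <= 1 / 2.
  apply: (@le_trans _ _ (L * (1 / (2 * (L + 1))))).
    by rewrite ler_wpM2l// !ge_min lexx orbT.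
  by rewrite mulrA mulr1 ler_pdivrMr ?mulr_gt0 ?ltr_wpDl//; lra.
have Ke : K * e <= r / 4.
  apply: (@le_trans _ _ (K * (r / (4 * (K + 1))))).
    by rewrite ler_wpM2l// !ge_min lexx !orbT.
  by rewrite mulrA ler_pdivrMr ?mulr_gt0 ?ltr_wpDl//; nra.
exists e => //.
have : \forall p \near p0, chart_dom (atlas i) p /\ ball x0 (r / 4) (atlas i p).
  apply: filterI; first exact: chart_dom_nbhs.
  by apply: (chart_map_continuous ip0); apply: nbhsx_ballx; rewrite divr_gt0.
apply: filterS => p [ip pr].
have [||u [cu u0 du]] := @picard R d (f \o P) L e (atlas i p) L0 gL.
- by rewrite e0 /=; lra.
- exact: Le.
have ux0 t : -e < t < e -> `|u t - x0| <= h.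
  move=> /andP[t0 t1]; have := @MVT_sym R d u e K t K0 cu; rewrite u0.
  have du' (s : R) : - e < s < e -> exists2 v, is_derive s 1 u v & `|v| <= K.
    by move=> se; exists (f (P (u s))); [exact: du|exact: gK].
  have te : -e <= t <= e by rewrite !ltW.
  move=> /(_ du' te) ut.
  rewrite -(subrKA (atlas i p)) (le_trans (ler_normD _ _))//.
  move: pr; rewrite -ball_normE /= distrC /h => pr; lra.
have uimg t : -e < t < e -> chart_img (atlas i) (u t).
  by move=> /ux0 ut; rewrite -(PK _ ut); have [] := rP _ (Pball (u t)).
exists (fun t => chart_inv (atlas i) (u t)); split; first by rewrite u0 chart_mapK.
move=> t te; have [q iq qu] := uimg t te.
apply: (@has_velocity_chart _ _ _ _ _ _ i) => //.
- apply: continuous_comp; first exact: cu.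
  by apply: chart_inv_continuous; exact: uimg.
- by rewrite -qu chart_mapK.
- apply: (@near_eq_is_derive _ _ _ u); last first.
    by have := du t te; rewrite /= PK//; exact: ux0.
  have : \forall s \near t, -e < s < e by exact: near_itv.
  by apply: filterS => s /uimg[q' iq' <-]; rewrite chart_mapK.
Unshelve. all: by end_near. Qed.

(** The property that lets solutions be continued: each step gains the same time. *)
Definition uniform_flow (R : realType) (d : nat) (M : smoothManifoldType R d)
    (F : vfield M) : Prop :=
  exists2 e : R, 0 < e & forall g : M,
    exists c : R -> M, c 0 = g /\ forall t, -e < t < e -> has_velocity F c t.

Lemma has_velocity_shift (R : realType) (d : nat) (M : smoothManifoldType R d)
    (F : vfield M) (c : R -> M) (t t1 : R) : has_velocity F c (t - t1) ->
  has_velocity F (fun s => c (s - t1)) t.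
Proof.
move=> [ct dc]; have cs : {for t, continuous (fun s : R => s - t1)}.
  by apply: continuousB; [exact: cvg_id|exact: cst_continuous].
split=> [|i it]; first by apply: continuous_comp; [exact: cs|exact: ct].
have ds : is_derive t 1 (fun s : R => s - t1) 1.
  by have := is_deriveB (is_derive_id t (1 : R)) (is_derive_cst t1 t 1); rewrite subr0.
have df := dc i it.
have dd : differentiable (fun s => atlas i (c s)) (t - t1).
  by apply/derivable1_diffP; case: df.
by have := is_derive_chain ds dd; case: df => _ ->.
Qed.

(** * Slices of maps of two variables, and a transport equation *)

Lemma is_derive_pair (R : realType) (V W : normedModType R) (f : R -> V)
    (g : R -> W) (t : R) (v : V) (w : W) :
  is_derive t 1 f v -> is_derive t 1 g w ->
  is_derive t 1 (fun s => (f s, g s)) (v, w).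
Proof.
move=> [fd <-] [gd <-].
have df : differentiable f t by exact/derivable1_diffP.
have dg : differentiable g t by exact/derivable1_diffP.
have dfg := is_diff_pair (differentiableP df) (differentiableP dg).
have d : differentiable (fun s => (f s, g s)) t by case: dfg.
apply: DeriveDef; first exact: diff_derivable.
rewrite (deriveE _ d) (deriveE _ df) (deriveE _ dg).
by have [_ e] := dfg; have /(congr1 (fun h => h 1)) := e.
Qed.

Lemma derive_pairl (R : realType) (U V W : normedModType R) (f : U * V -> W)
    (x u : U) (y : V) : 'D_(u, 0) f (x, y) = 'D_u (fun x' => f (x', y)) x.
Proof.
rewrite /derive; set g1 := fun h : R => _; set g2 := fun h : R => _.
suff -> : g1 = g2 by [].
apply/funext => h; rewrite /g1 /g2 /=; congr (_ *: (f _ - _)).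
by congr (_, _); rewrite /= scaler0 add0r.
Qed.

Lemma derive_pairr (R : realType) (U V W : normedModType R) (f : U * V -> W)
    (x : U) (y v : V) : 'D_(0, v) f (x, y) = 'D_v (fun y' => f (x, y')) y.
Proof.
rewrite /derive; set g1 := fun h : R => _; set g2 := fun h : R => _.
suff -> : g1 = g2 by [].
apply/funext => h; rewrite /g1 /g2 /=; congr (_ *: (f _ - _)).
by congr (_, _); rewrite /= scaler0 add0r.
Qed.

Lemma differentiable_slicel (R : realType) (U V W : normedModType R)
    (f : U * V -> W) (x : U) (y : V) : differentiable f (x, y) ->
  differentiable (fun x' => f (x', y)) x.
Proof.
by move=> df; apply: (@differentiable_comp _ _ _ _ (fun x' : U => (x', y)) f).
Qed.

Lemma differentiable_slicer (R : realType) (U V W : normedModType R)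
    (f : U * V -> W) (x : U) (y : V) : differentiable f (x, y) ->
  differentiable (fun y' => f (x, y')) y.
Proof.
by move=> df; apply: (@differentiable_comp _ _ _ _ (fun y' : V => (x, y')) f).
Qed.

Lemma nbhs_slicel (T U : topologicalType) (x : T) (y : U) (A : set (T * U)) :
  nbhs (x, y) A -> \forall x' \near x, A (x', y).
Proof.
case=> -[B C] /= [Bx Cy] BC; apply: filterS Bx => x' Bx'.
by apply: BC; split => //=; exact: nbhs_singleton.
Qed.

Lemma nbhs_slicer (T U : topologicalType) (x : T) (y : U) (A : set (T * U)) :
  nbhs (x, y) A -> \forall y' \near y, A (x, y').
Proof.
case=> -[B C] /= [Bx Cy] BC; apply: filterS Cy => y' Cy'.
by apply: BC; split => //=; exact: nbhs_singleton.
Qed.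

Lemma Ck_slicel (R : realType) (U V W : normedModType R) (k : nat)
    (A : set (U * V)) (f : U * V -> W) (y : V) :
  Ck k A f -> Ck k [set x | A (x, y)] (fun x => f (x, y)).
Proof.
elim: k f => [|k ih] f /=.
  move=> cf x Ax B nB; exact: (nbhs_slicel (cf _ Ax B nB)).
move=> [df Cf]; split=> [x Ax|v]; first exact/differentiable_slicel/df.
have -> : 'D_v (fun x => f (x, y)) = (fun x => 'D_(v, 0) f (x, y)).
  by apply/funext => x; rewrite derive_pairl.
exact: (ih ('D_(v, 0) f) (Cf _)).
Qed.

Lemma Ck_slicer (R : realType) (U V W : normedModType R) (k : nat)
    (A : set (U * V)) (f : U * V -> W) (x : U) :
  Ck k A f -> Ck k [set y | A (x, y)] (fun y => f (x, y)).
Proof.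
elim: k f => [|k ih] f /=.
  move=> cf y Ay B nB; exact: (nbhs_slicer (cf _ Ay B nB)).
move=> [df Cf]; split=> [y Ay|v]; first exact/differentiable_slicer/df.
have -> : 'D_v (fun y => f (x, y)) = (fun y => 'D_(0, v) f (x, y)).
  by apply/funext => y; rewrite derive_pairr.
exact: (ih ('D_(0, v) f) (Cf _)).
Qed.

Lemma Ck_sub (R : realType) (V W : normedModType R) (k : nat) (A B : set V)
    (f : V -> W) : B `<=` A -> Ck k A f -> Ck k B f.
Proof.
move=> BA; elim: k f => [|k ih] f /=; first by move=> cf x /BA /cf.
by move=> [df Cf]; split=> [x /BA /df//|v]; exact: ih.
Qed.

Lemma open_slicel (T U : topologicalType) (A : set (T * U)) (y : U) :
  open A -> open [set x | A (x, y)].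
Proof.
rewrite !openE => oA x Axy; exact: (nbhs_slicel (oA _ Axy)).
Qed.

Lemma derive_of (R : realType) (V W : normedModType R) (f g : V -> W) (x v : V)
    (l : W) : (\forall z \near x, f z = g z) -> 'D_v g x = l -> 'D_v f x = l.
Proof. by move=> fg <-; exact: near_eq_derive. Qed.

Lemma transport_algebra (V : zmodType) (e p1 p2 p3 p4 q1 q2 m : V) :
  e = p1 - (p2 + p3) - p4 -> q1 - p1 = q2 - p2 -> m = q2 + p3 -> e = q1 - m - p4.
Proof.
move=> -> h ->; congr (_ - _); rewrite -[p1](subKr q1) h -addrA -opprD.
by rewrite addrA subrK.
Qed.

Section bracket_transport.
Variables (R : realType) (d : nat).
Notation E := 'rV[R]_d.
Variables (D : set (E * E)) (N : E * E -> E) (x y : E).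
Variables (Xi Yi Xk Yk : E -> E) (xi : E).
Hypotheses (oD : open D) (CN : Ck 2 D N) (Dxy : D (x, y)).
Hypotheses (dXi : differentiable Xi x) (dYi : differentiable Yi x).
Hypotheses (dXk : differentiable Xk (N (x, y))) (dYk : differentiable Yk (N (x, y))).
Hypothesis YN : \forall z \near (x, y), Yk (N z) = 'D_(Yi z.1, 0) N z.

(** [discrepancy] measures by how much the value of [X] at a product differs
    from the derivative of the product along [X] in the first factor and [xi]
    in the second. *)
Definition discrepancy (x' : E) : E := Xk (N (x', y)) - 'D_(Xi x', xi) N (x', y).

Let r x' := N (x', y).
Let B := [set x' | D (x', y)].
Let oB : open B. Proof. exact: open_slicel. Qed.
Let Cr : Ck 2 B r. Proof. exact: Ck_slicel. Qed.
Let Bx : B x. Proof. exact: Dxy. Qed.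
Let dN z : D z -> differentiable N z. Proof. exact: Ck_differentiable CN. Qed.
Let dDN v z : D z -> differentiable ('D_v N) z.
Proof. by case: CN => _ /(_ v)[h _]; exact: h. Qed.
Let dr : differentiable r x. Proof. exact: (Ck_differentiable Cr Bx). Qed.
Let nB : \forall x' \near x, D (x', y).
Proof. exact: (open_nbhs_nbhs (conj oB Bx)). Qed.

Let discrepancyE : \forall x' \near x,
  discrepancy x' = Xk (r x') - 'D_(Xi x') r x' - 'D_(0, xi) N (x', y).
Proof.
apply: filterS nB => x' Dx'; rewrite /discrepancy -[in RHS]addrA; congr (_ + _).
have -> : (Xi x', xi) = (Xi x', 0) + (0, xi) :> E * E.
  by congr (_, _); rewrite ?addr0 ?add0r.
by rewrite deriveD_dir ?opprD ?derive_pairl//; exact: dN.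
Qed.

Let dXr : differentiable (fun x' => Xk (r x')) x.
Proof. exact: (@differentiable_comp _ _ _ _ r Xk). Qed.

Let dXir : differentiable (fun x' => 'D_(Xi x') r x') x.
Proof. exact: (differentiable_along_field oB Cr Bx dXi). Qed.

Let dxiN : differentiable (fun x' => 'D_(0, xi) N (x', y)) x.
Proof. by apply: (@differentiable_slicel _ _ _ _ ('D_(0, xi) N)); exact: dDN. Qed.

Lemma differentiable_discrepancy : differentiable discrepancy x.
Proof.
apply: near_eq_differentiable.
  by apply: filterS discrepancyE => x' h; exact: esym h.
exact: (differentiableB (differentiableB dXr dXir) dxiN).
Qed.

Let Yr : \forall x' \near x, Yk (r x') = 'D_(Yi x') r x'.
Proof. by apply: filterS (nbhs_slicel YN) => x' /= ->; rewrite derive_pairl. Qed.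

Let rY : 'D_(Yi x) r x = Yk (r x).
Proof. exact: esym (nbhs_singleton Yr). Qed.

Let d1 : 'D_(Yi x) (fun x' => Xk (r x')) x = 'D_(Yk (r x)) Xk (r x).
Proof. by rewrite (derive_chain (Yi x) dr dXk) rY. Qed.

Let d2 := derive_along_field oB Cr Bx dXi (Yi x).

(* The order of differentiation is exchanged, then [YN] is differentiated in the
   second variable. *)
Let d3 : 'D_(Yi x) (fun x' => 'D_(0, xi) N (x', y)) x =
  'D_('D_(0, xi) N (x, y)) Yk (r x).
Proof.
have -> : 'D_(Yi x) (fun x' => 'D_(0, xi) N (x', y)) x =
    'D_(Yi x, 0) ('D_(0, xi) N) (x, y) by rewrite (derive_pairl ('D_(0, xi) N)).
have -> : 'D_(Yi x, 0) ('D_(0, xi) N) (x, y) = 'D_(0, xi) ('D_(Yi x, 0) N) (x, y).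
  exact: (derive_swap _ _ oD CN Dxy).
rewrite (derive_pairr ('D_(Yi x, 0) N)) derive_pairr.
have YNy : \forall y' \near y, 'D_(Yi x, 0) N (x, y') = Yk (N (x, y')).
  by apply: filterS (nbhs_slicer YN) => y' /= ->.
apply: (derive_of YNy).
exact: (derive_chain xi (differentiable_slicer (dN Dxy)) dYk).
Qed.

(* [YN] is differentiated along [Xi] in the first variable. *)
Let d4 : 'D_('D_(Xi x) r x) Yk (r x) =
  'D_('D_(Xi x) Yi x) r x + 'D_(Yi x) ('D_(Xi x) r) x.
Proof.
have <- : 'D_(Xi x) ('D_(Yi x) r) x = 'D_(Yi x) ('D_(Xi x) r) x.
  exact: (derive_swap _ _ oB Cr Bx).
have <- := derive_along_field oB Cr Bx dYi (Xi x).
rewrite -(derive_chain (Xi x) dr dYk); exact: near_eq_derive.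
Qed.

(** If [Y] is transported to itself by the first partial derivatives of [N], and
    [[X, Y]] is too, then differentiating the discrepancy of [X] along [Y]
    leaves only a term linear in the discrepancy: the second derivatives of [N]
    cancel by their symmetry. *)
Lemma derive_discrepancy :
  'D_(Xk (N (x, y))) Yk (N (x, y)) - 'D_(Yk (N (x, y))) Xk (N (x, y)) =
    'D_('D_(Xi x) Yi x - 'D_(Yi x) Xi x, 0) N (x, y) ->
  'D_(Yi x) discrepancy x = 'D_(discrepancy x) Yk (N (x, y)).
Proof.
rewrite derive_pairl (deriveB_dir _ _ dr) => br.
have -> : 'D_(discrepancy x) Yk (N (x, y)) =
    'D_(Xk (N (x, y))) Yk (N (x, y)) - 'D_('D_(Xi x) r x) Yk (r x)
    - 'D_('D_(0, xi) N (x, y)) Yk (r x).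
  by rewrite (nbhs_singleton discrepancyE) !deriveB_dir.
have h1 := derivableP (diff_derivable (v := Yi x) dXr).
have h2 := derivableP (diff_derivable (v := Yi x) dXir).
have h3 := derivableP (diff_derivable (v := Yi x) dxiN).
have [_ dB] := is_deriveB (is_deriveB h1 h2) h3.
have dE := near_eq_derive (Yi x) discrepancyE.
apply: transport_algebra br d4; rewrite dE; apply: (etrans dB).
exact: (f_equal2 (fun p q => p - q) (f_equal2 (fun p q => p - q) d1 d2) d3).
Qed.
End bracket_transport.

(** * Multiplication in charts and right-invariant fields *)

Section lie_group.
Variables (R : realType) (d : nat) (G : lieGroupType R d).
Implicit Types (i j k : atlas_index G) (a b p g h : G) (F H : vfield G).
Notation E := 'rV[R]_d.

Definition mul_chart i j k (z : E * E) : E :=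
  atlas k (chart_inv (atlas i) z.1 * chart_inv (atlas j) z.2)%g.

Definition mul_dom i j k : set (E * E) :=
  [set z | [/\ chart_img (atlas i) z.1, chart_img (atlas j) z.2 &
     chart_dom (atlas k) (chart_inv (atlas i) z.1 * chart_inv (atlas j) z.2)%g]].

Lemma mul_domP i j k a b : chart_dom (atlas i) a -> chart_dom (atlas j) b ->
  chart_dom (atlas k) (a * b)%g -> mul_dom i j k (atlas i a, atlas j b).
Proof. by move=> ia jb kab; split=> /=; [exists a|exists b|rewrite !chart_mapK]. Qed.

Lemma mul_continuous_at (T : topologicalType) (c c' : T -> G) (t : T) :
  {for t, continuous c} -> {for t, continuous c'} ->
  {for t, continuous (fun s => (c s * c' s)%g)}.
Proof.
move=> ct ct' U nU.
have [[A B] /= [nA nB] AB] := @lie_mul_continuous R d G (c t, c' t) U nU.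
have nAt : \forall s \near t, A (c s) by exact: ct.
have nBt : \forall s \near t, B (c' s) by exact: ct'.
suff : \forall s \near t, U (c s * c' s)%g by [].
apply: filterS2 nAt nBt => s As Bs; exact: (AB (c s, c' s) (conj As Bs)).
Qed.

Lemma mul_dom_open i j k : open (mul_dom i j k).
Proof.
rewrite openE => -[x y] /= [[a ia /= <-] [b jb /= <-]]; rewrite /= !chart_mapK// => kab.
rewrite /interior.
have c1 : {for (atlas i a, atlas j b), continuous (fun z : E * E => chart_inv (atlas i) z.1)}.
  by apply: continuous_comp; [exact: cvg_fst|exact: chart_inv_at].
have c2 : {for (atlas i a, atlas j b), continuous (fun z : E * E => chart_inv (atlas j) z.2)}.
  by apply: continuous_comp; [exact: cvg_snd|exact: chart_inv_at].
have n1 : \forall z \near (atlas i a, atlas j b), chart_img (atlas i) z.1.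
  exists (chart_img (atlas i), setT) => [|z []//].
  by split; [exact: chart_img_nbhs|exact: filterT].
have n2 : \forall z \near (atlas i a, atlas j b), chart_img (atlas j) z.2.
  exists (setT, chart_img (atlas j)) => [|z []//].
  by split; [exact: filterT|exact: chart_img_nbhs].
have n3 : \forall z \near (atlas i a, atlas j b),
    chart_dom (atlas k) (chart_inv (atlas i) z.1 * chart_inv (atlas j) z.2)%g.
  apply: (mul_continuous_at c1 c2).
  by rewrite /= !chart_mapK//; exact: chart_dom_nbhs.
suff : \forall z \near (atlas i a, atlas j b), mul_dom i j k z by [].
by apply: filterS3 n1 n2 n3 => z; split.
Qed.

Lemma mul_chart_smooth n i j k : Ck n (mul_dom i j k) (mul_chart i j k).
Proof. exact: lie_mul_smooth. Qed.

Lemma mul_chart_differentiable i j k a b : chart_dom (atlas i) a ->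
  chart_dom (atlas j) b -> chart_dom (atlas k) (a * b)%g ->
  differentiable (mul_chart i j k) (atlas i a, atlas j b).
Proof.
move=> ia jb kab; exact: (Ck_differentiable (mul_chart_smooth 1 i j k) (mul_domP ia jb kab)).
Qed.

(** The differential of the right translation by [g]. *)
Definition rtrans g i j p (v : E) : E := tangent_map (fun x : G => (x * g)%g) i j p v.

Lemma rtransE g i j k p v : chart_dom (atlas j) g ->
  rtrans g i k p v = 'D_(v, 0) (mul_chart i j k) (atlas i p, atlas j g).
Proof. by move=> jg; rewrite derive_pairl /mul_chart /= chart_mapK. Qed.

Lemma rtrans_differentiable g i k p : chart_dom (atlas i) p ->
  chart_dom (atlas k) (p * g)%g ->
  differentiable (fun x => atlas k (chart_inv (atlas i) x * g)%g) (atlas i p).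
Proof.
move=> ip kpg; have [j jg] := atlas_cover g.
by have := differentiable_slicel (mul_chart_differentiable ip jg kpg);
  rewrite /mul_chart /= chart_mapK.
Qed.

Lemma rtrans_near g i j p : chart_dom (atlas i) p -> chart_dom (atlas j) (p * g)%g ->
  \forall x \near atlas i p, chart_dom (atlas j) (chart_inv (atlas i) x * g)%g.
Proof.
move=> ip jpg.
have c : {for atlas i p, continuous (fun x => chart_inv (atlas i) x * g)%g}.
  have cg : {for atlas i p, continuous (fun _ : E => g)} by exact: cst_continuous.
  exact: (mul_continuous_at (chart_inv_at ip) cg).
by apply: c; rewrite chart_mapK//; exact: chart_dom_nbhs.
Qed.

(** The chain rule for [R_h \o R_g = R_(gh)]. *)
Lemma rtrans_comp g h i j k p v : chart_dom (atlas i) p ->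
  chart_dom (atlas j) (p * g)%g -> chart_dom (atlas k) (p * g * h)%g ->
  rtrans h j k (p * g)%g (rtrans g i j p v) = rtrans (g * h)%g i k p v.
Proof.
move=> ip jpg kpgh; rewrite /rtrans /tangent_map.
have e : atlas j (chart_inv (atlas i) (atlas i p) * g)%g = atlas j (p * g)%g.
  by rewrite chart_mapK.
rewrite -e -derive_chain.
- apply: near_eq_derive; apply: filterS (rtrans_near ip jpg) => x jx.
  by rewrite chart_mapK// mulgA.
- exact: rtrans_differentiable.
- by rewrite e; exact: rtrans_differentiable.
Qed.

Lemma rtrans1 i p v : chart_dom (atlas i) p -> rtrans 1%g i i p v = v.
Proof.
move=> ip; rewrite /rtrans /tangent_map -[RHS](derive_id (atlas i p)).
apply: near_eq_derive; apply: filterS (chart_img_nbhs ip) => x [q iq <-].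
by rewrite chart_mapK// mulg1.
Qed.

Let e0 : atlas_index G := sval (cid (atlas_cover (1%g : G))).
Let e0P : chart_dom (atlas e0) (1%g : G) := svalP (cid (atlas_cover (1%g : G))).

(** The right-invariant field with value [v] at the identity. *)
Definition rext (v : E) : vfield G := fun i p => rtrans p e0 i 1%g v.

Lemma rext_right_invariant v : right_invariant (rext v).
Proof.
have inv g p i j : chart_dom (atlas i) p -> chart_dom (atlas j) (p * g)%g ->
    rext v j (p * g)%g = rtrans g i j p (rext v i p).
  by move=> ip jpg; rewrite /rext -[p in rtrans g i j p _]mul1g rtrans_comp ?mul1g.
split=> //; split=> [i j p ip jp|i n].
  have {1}-> : p = (p * 1)%g by rewrite mulg1.
  rewrite (inv _ _ i)// ?mulg1//.
  by rewrite /rtrans /tangent_map; under eq_fun do rewrite mulg1.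
have D x : chart_img (atlas i) x -> mul_dom e0 i i (atlas e0 (1%g : G), x).
  by move=> [p ip <-]; apply: mul_domP; rewrite ?mul1g.
have -> : rext v i \o chart_inv (atlas i) = 
    (fun x => 'D_(v, 0) (mul_chart e0 i i) (atlas e0 (1%g : G), x)).
  by apply/funext => x; rewrite derive_pairl.
apply: Ck_sub D _; apply: (@Ck_slicer _ _ _ _ _ _ ('D_(v, 0) (mul_chart e0 i i))).
by have [_ C] := mul_chart_smooth n.+1 e0 i i; exact: C.
Qed.

(** The preimage of [u] is its transport to the identity by the right translation
    by [p^-1]. *)
Lemma rext_surjective i p (u : E) : chart_dom (atlas i) p ->
  exists v, rext v i p = u.
Proof.
move=> ip; exists (rtrans p^-1%g i e0 p u); rewrite /rext.
have e0p : chart_dom (atlas e0) (p * p^-1)%g by rewrite mulgV.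
by rewrite -(mulgV p) rtrans_comp ?mulgV ?mul1g ?mulVg ?rtrans1.
Qed.

Definition mul_eq F H i j k a b : Prop :=
  F k (a * b)%g = 'D_(F i a, H j b) (mul_chart i j k) (atlas i a, atlas j b).

(** Along curves: if [F] and [H] are the velocities of two curves, then [F] is
    the velocity of their product. *)
Definition mul_related F H : Prop := forall i j k a b, chart_dom (atlas i) a ->
  chart_dom (atlas j) b -> chart_dom (atlas k) (a * b)%g -> mul_eq F H i j k a b.

Lemma velocity_mul_chart F H (c c' : R -> G) (t : R) i j k :
  chart_dom (atlas i) (c t) -> chart_dom (atlas j) (c' t) ->
  chart_dom (atlas k) (c t * c' t)%g ->
  has_velocity F c t -> has_velocity H c' t ->
  is_derive t 1 (fun s => atlas k (c s * c' s)%g)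
    ('D_(F i (c t), H j (c' t)) (mul_chart i j k) (atlas i (c t), atlas j (c' t))).
Proof.
move=> it jt kt [ct dc] [ct' dc'].
have nc : \forall s \near t, chart_dom (atlas i) (c s) by exact/ct/chart_dom_nbhs.
have nc' : \forall s \near t, chart_dom (atlas j) (c' s) by exact/ct'/chart_dom_nbhs.
apply: (@near_eq_is_derive _ _ _ (fun s => mul_chart i j k (atlas i (c s), atlas j (c' s)))).
  by apply: filterS2 nc nc' => s is_ js; rewrite /mul_chart /= !chart_mapK.
have di := dc i it; have dj := dc' j jt.
apply: (@is_derive_chain _ _ _ (fun s => (atlas i (c s), atlas j (c' s)))); last first.
  exact: mul_chart_differentiable.
exact: is_derive_pair.
Qed.

Lemma has_velocity_mul F H (c c' : R -> G) (t : R) i j k : compat_vfield F ->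
  chart_dom (atlas i) (c t) -> chart_dom (atlas j) (c' t) ->
  chart_dom (atlas k) (c t * c' t)%g -> mul_eq F H i j k (c t) (c' t) ->
  has_velocity F c t -> has_velocity H c' t ->
  has_velocity F (fun s => (c s * c' s)%g) t.
Proof.
move=> Fc it jt kt FH cv cv'; apply: (has_velocity_chart Fc _ kt).
  by apply: mul_continuous_at; [case: cv|case: cv'].
by rewrite FH; exact: velocity_mul_chart.
Qed.

(** Both sides are the velocity of one and the same curve: the product of two
    integral curves of [F] and [H]. *)
Lemma mul_eq_charts F H i j k i' j' k' a b : lip_vfield F -> lip_vfield H ->
  chart_dom (atlas i) a -> chart_dom (atlas j) b -> chart_dom (atlas k) (a * b)%g ->
  chart_dom (atlas i') a -> chart_dom (atlas j') b ->
  chart_dom (atlas k') (a * b)%g ->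
  mul_eq F H i j k a b -> mul_eq F H i' j' k' a b.
Proof.
move=> lF lH ia jb kab ia' jb' kab' FH.
have curve K p : lip_vfield K -> exists c : R -> G, c 0 = p /\ has_velocity K c 0.
  move=> /(local_flow p)[r r0 /nbhs_singleton[c [c0 cv]]].
  by exists c; split=> //; apply: cv; rewrite oppr_lt0 r0.
have [c [c0 cv]] := curve F a lF; have [c' [c0' cv']] := curve H b lH.
rewrite -c0 -c0' in ia jb kab ia' jb' kab' FH *.
have [_ dF] := has_velocity_mul lF.1 ia jb kab FH cv cv'.
have [_ dE] := dF k' kab'.
have [_ dM] := velocity_mul_chart ia' jb' kab' cv cv'.
exact: etrans (esym dE) dM.
Qed.

End lie_group.

(** * Linear fields and the multiplication *)

Lemma near_continuous (T U : topologicalType) (f : T -> U) (x : T) (P : set U) :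
  {for x, continuous f} -> (\forall y \near f x, P y) -> \forall z \near x, P (f z).
Proof. by move=> cf nP; exact: (cf _ nP). Qed.

Section affine_fields.
Variables (R : realType) (d : nat) (G : lieGroupType R d).
Implicit Types (i j k : atlas_index G) (a b p g h : G) (F H X Y : vfield G).
Notation E := 'rV[R]_d.

Lemma mul_chartE i j k a b : chart_dom (atlas i) a -> chart_dom (atlas j) b ->
  mul_chart i j k (atlas i a, atlas j b) = atlas k (a * b)%g.
Proof. by move=> ia jb; rewrite /mul_chart /= !chart_mapK. Qed.

Lemma right_invariant_mul_related Y : right_invariant Y ->
  mul_related Y (fun _ _ => 0).
Proof.
move=> [_ Yr] i j k a b ia jb kab; rewrite /mul_eq (Yr b a i k)//.
exact: rtransE.
Qed.

Lemma smooth_vfield_differentiable F i p : smooth_vfield F ->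
  chart_dom (atlas i) p -> differentiable (F i \o chart_inv (atlas i)) (atlas i p).
Proof. by move=> [_ /(_ i 1%N)[dF _]] ip; apply: dF; exists p. Qed.

Definition mul_discrepancy X i j k b : E -> E :=
  discrepancy (mul_chart i j k) (atlas j b) (X i \o chart_inv (atlas i))
    (X k \o chart_inv (atlas k)) (X j b).

Lemma mul_discrepancyP X i j k a b : chart_dom (atlas i) a -> chart_dom (atlas j) b ->
  chart_dom (atlas k) (a * b)%g ->
  mul_discrepancy X i j k b (atlas i a) = 0 <-> mul_eq X X i j k a b.
Proof.
move=> ia jb kab; rewrite /mul_discrepancy /discrepancy mul_chartE// /= !chart_mapK//.
by rewrite /mul_eq; split=> [/eqP|->]; rewrite ?subrr// subr_eq0 => /eqP.
Qed.

Lemma differentiable_mul_discrepancy X i j k a b : smooth_vfield X ->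
  chart_dom (atlas i) a -> chart_dom (atlas j) b ->
  chart_dom (atlas k) (a * b)%g ->
  differentiable (mul_discrepancy X i j k b) (atlas i a).
Proof.
move=> sX ia jb kab; apply: differentiable_discrepancy.
- exact: (mul_dom_open (i := i) (j := j) (k := k)).
- exact: mul_chart_smooth.
- exact: mul_domP.
- exact: smooth_vfield_differentiable.
- by rewrite mul_chartE//; exact: smooth_vfield_differentiable.
Qed.

(** The bracket condition of [derive_discrepancy] holds because [[X, Y]] is
    right-invariant. *)
Lemma derive_mul_discrepancy X Y i j k a b : affine_vfield X -> right_invariant Y ->
  chart_dom (atlas i) a -> chart_dom (atlas j) b ->
  chart_dom (atlas k) (a * b)%g ->
  'D_(Y i a) (mul_discrepancy X i j k b) (atlas i a) =
  'D_(mul_discrepancy X i j k b (atlas i a)) (Y k \o chart_inv (atlas k))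
     (atlas k (a * b)%g).
Proof.
move=> [sX aX] rY ia jb kab; have sY := rY.1.
have := @derive_discrepancy R d (mul_dom i j k) (mul_chart i j k) (atlas i a)
  (atlas j b) (X i \o chart_inv (atlas i)) (Y i \o chart_inv (atlas i))
  (X k \o chart_inv (atlas k)) (Y k \o chart_inv (atlas k)) (X j b).
rewrite mul_chartE// /= !chart_mapK//; apply.
- exact: mul_dom_open.
- exact: (mul_chart_smooth 2 i j k).
- exact: mul_domP.
- exact: smooth_vfield_differentiable.
- exact: smooth_vfield_differentiable.
- exact: smooth_vfield_differentiable.
- exact: smooth_vfield_differentiable.
- have nD := open_nbhs_nbhs (conj (@mul_dom_open _ _ _ i j k) (mul_domP ia jb kab)).
  apply: filterS nD => -[x y] [[a' ia' /= <-] [b' jb' /= <-] kab'].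
  move: kab'; rewrite /= (chart_mapK ia') (chart_mapK jb') => kab'.
  rewrite mul_chartE// (chart_mapK kab').
  exact: right_invariant_mul_related.
- have [_ br] := aX Y rY; have := br b a i k ia kab; rewrite /lie_bracket => ->.
  exact: rtransE.
Qed.

Lemma near_mulr_dom k a0 b : chart_dom (atlas k) (a0 * b)%g ->
  \forall a \near a0, chart_dom (atlas k) (a * b)%g.
Proof.
move=> kab; have c1 : {for a0, continuous (fun a : G => a)} by exact: cvg_id.
have c2 : {for a0, continuous (fun _ : G => b)} by exact: cst_continuous.
exact: (near_continuous (mul_continuous_at c1 c2) (chart_dom_nbhs kab)).
Qed.

(** Right-invariant fields that form the standard basis at [a0] make
    [locally_zero] applicable to the discrepancy. *)
Lemma mul_eq_near X i j k a0 b : affine_vfield X ->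
  chart_dom (atlas i) a0 -> chart_dom (atlas j) b ->
  chart_dom (atlas k) (a0 * b)%g -> mul_eq X X i j k a0 b ->
  \forall a \near a0,
    [/\ chart_dom (atlas i) a, chart_dom (atlas k) (a * b)%g & mul_eq X X i j k a b].
Proof.
move=> aX ia jb kab X0; have sX := aX.1.
have [v vP] := choice (fun l => rext_surjective (delta_mx 0 l) ia).
have rY l := rext_right_invariant G (v l).
pose q x := atlas k (chart_inv (atlas i) x * b)%g.
have nk := rtrans_near ia kab.
have nik : \forall x \near atlas i a0, exists2 a, x = atlas i a &
    chart_dom (atlas i) a /\ chart_dom (atlas k) (a * b)%g.
  apply: filterS2 nk (chart_img_nbhs ia) => x kx [a ia' ax]; exists a => //.
  by rewrite -ax chart_mapK// in kx.
have cq : {for atlas i a0, continuous q}.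
  exact/differentiable_continuous/rtrans_differentiable.
have q0 : q (atlas i a0) = atlas k (a0 * b)%g by rewrite /q chart_mapK.
have bound l : exists C : R, 0 <= C /\ \forall x \near atlas i a0,
    forall w, `|'D_w (rext (v l) k \o chart_inv (atlas k)) (q x)| <= C * `|w|.
  have [|||C C0 nC] := @Ck1_bounded R d _ (chart_img (atlas k))
      (rext (v l) k \o chart_inv (atlas k)) (atlas k (a0 * b)%g).
  - exact: chart_img_open.
  - by have [[_ sY] _] := rY l; exact: sY.
  - by exists (a0 * b)%g.
  exists C; split; first exact: C0.
  pose T z := forall w, `|'D_w (rext (v l) k \o chart_inv (atlas k)) z| <= C * `|w|.
  have nT : nbhs (q (atlas i a0)) T by rewrite q0; exact: nC.
  exact: (near_continuous (P := T) cq nT).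
have [C CP] := choice bound.
have C0 l : 0 <= C l by have [] := CP l.
suff : \forall x \near atlas i a0, mul_discrepancy X i j k b x = 0.
  move=> n0; have n0' : \forall a \near a0, mul_discrepancy X i j k b (atlas i a) = 0.
    exact: (near_continuous (chart_map_continuous ia) n0).
  have nk' : \forall a \near a0, chart_dom (atlas k) (a * b)%g.
    exact: near_mulr_dom.
  apply: filterS3 (chart_dom_nbhs ia) nk' n0' => a ia' kab' z; split=> //.
  exact/mul_discrepancyP.
apply: (@locally_zero R d d _ (fun l x => rext (v l) i (chart_inv (atlas i) x)) _
  (\sum_l C l)).
- exact: sumr_ge0.
- apply: filterS nik => x [a -> [ia' kab']].
  exact: differentiable_mul_discrepancy.
- move=> l; apply: differentiable_continuous.
  exact: (smooth_vfield_differentiable (rY l).1 ia).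
- by move=> l; rewrite chart_mapK.
- move=> l; have [_ nC] := CP l; apply: filterS2 nik nC => x [a -> [ia' kab']] bC.
  rewrite [in rext _ _ _]chart_mapK//.
  have := derive_mul_discrepancy aX (rY l) ia' jb kab' => ->.
  move: (bC (mul_discrepancy X i j k b (atlas i a))); rewrite /q chart_mapK// => bd.
  apply: (le_trans bd); rewrite ler_wpM2r// (bigD1 l)//= lerDl.
  exact: sumr_ge0.
- exact/mul_discrepancyP.
Qed.

(** [mul_related X X] holds at [(1, b)] because [X] vanishes at the identity,
    and the set of [a] such that it holds at [(a, b)] is open and closed. *)
Lemma linear_mul_related X : connected [set: G] -> linear_vfield X ->
  mul_related X X.
Proof.
move=> cG [aX X1] i j k a b ia jb kab; have sX := aX.1; have lX := smooth_lip sX.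
pose P a' := forall i' k', chart_dom (atlas i') a' -> chart_dom (atlas k') (a' * b)%g ->
  mul_eq X X i' j k' a' b.
suff PT : [set a' | P a'] = [set: G] by have : [set: G] a by []; rewrite -PT; exact.
apply: cG.
- exists 1%g => i' k' i1 k1; rewrite mul1g in k1 *; rewrite /mul_eq mul1g.
  rewrite (X1 i' i1) derive_pairr (sX.1 j k' b jb k1) /tangent_map.
  by rewrite /mul_chart /= chart_mapK//; under [in RHS]eq_fun do rewrite mul1g.
- exists [set a' | P a']; last by rewrite setTI.
  rewrite openE => a' Pa'; have [i' ia'] := atlas_cover a'.
  have [k' kab'] := atlas_cover (a' * b)%g.
  apply: filterS (mul_eq_near aX ia' jb kab' (Pa' _ _ ia' kab')).
  move=> a1 [ia1 kab1 e1] i1 k1 ia1' kab1'.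
  exact: (mul_eq_charts lX lX ia1 jb kab1 ia1' jb kab1').
- exists [set a' | P a']; last by rewrite setTI.
  rewrite -openC openE => a' /= nPa'.
  have [i' ia'] := atlas_cover a'; have [k' kab'] := atlas_cover (a' * b)%g.
  have ne0 : mul_discrepancy X i' j k' b (atlas i' a') != 0.
    apply/eqP => /(mul_discrepancyP X ia' jb kab') e; apply: nPa' => i1 k1 ia1 kab1.
    exact: (mul_eq_charts lX lX ia' jb kab' ia1 jb kab1).
  have cD : {for a', continuous (fun a => mul_discrepancy X i' j k' b (atlas i' a))}.
    apply: continuous_comp; first exact: chart_map_continuous.
    exact/differentiable_continuous/differentiable_mul_discrepancy.
  have nD : \forall a \near a', `|mul_discrepancy X i' j k' b (atlas i' a')
      - mul_discrepancy X i' j k' b (atlas i' a)|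
      < `|mul_discrepancy X i' j k' b (atlas i' a')|.
    by move/cvgrPdist_lt : cD; apply; rewrite normr_gt0.
  suff : \forall a \near a', ~ P a by [].
  apply: filterS3 nD (chart_dom_nbhs ia') (near_mulr_dom kab') => a1 D1 ia1 kab1 Pa1.
  have /(mul_discrepancyP X ia1 jb kab1) D0 := Pa1 _ _ ia1 kab1.
  by rewrite D0 subr0 ltxx in D1.
Qed.
End affine_fields.

(** * Uniform times of existence on Lie groups *)

Section flows.
Variables (R : realType) (d : nat) (G : lieGroupType R d).
Hypothesis cG : connected [set: G].
Implicit Types (a b p g h : G) (F H X Y : vfield G).

Lemma affine_mul_related F X Y : eq_vfield F (add_vfield X Y) ->
  linear_vfield X -> right_invariant Y -> mul_related F X.
Proof.
move=> FXY lX rY i j k a b ia jb kab; have dM := mul_chart_differentiable ia jb kab.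
have eX := linear_mul_related cG lX ia jb kab.
have eY := right_invariant_mul_related rY ia jb kab.
rewrite /mul_eq (FXY k _ kab) (FXY i _ ia) /add_vfield eX eY -(deriveD_dir _ _ dM).
by congr (derive _ _ (_, _)); rewrite /= addr0.
Qed.

Lemma system_mul_related (m : nat) (F X : 'I_m.+1 -> vfield G) (u : 'rV[R]_m) :
  (forall l, mul_related (F l) (X l)) ->
  mul_related (system_field F u) (system_field X u).
Proof.
move=> FX i j k a b ia jb kab; have dM := mul_chart_differentiable ia jb kab.
rewrite /mul_eq /system_field.
have -> : (F ord0 i a + \sum_(l < m) u 0 l *: F (lift ord0 l) i a,
    X ord0 j b + \sum_(l < m) u 0 l *: X (lift ord0 l) j b) =
    (F ord0 i a, X ord0 j b) +
      \sum_(l < m) u 0 l *: (F (lift ord0 l) i a, X (lift ord0 l) j b).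
  apply/pair_equal_spec; split=> /=.
    by congr (_ + _); rewrite (big_morph fst (id1 := 0) (op1 := +%R)).
  by congr (_ + _); rewrite (big_morph snd (id1 := 0) (op1 := +%R)).
rewrite deriveE// linearD linear_sum -deriveE//.
congr (_ + _); first exact: FX.
by apply: eq_bigr => l _; rewrite linearZ -deriveE//; congr (_ *: _); exact: FX.
Qed.

Lemma mul_has_velocity F H (c c' : R -> G) (t : R) : lip_vfield F ->
  mul_related F H -> has_velocity F c t -> has_velocity H c' t ->
  has_velocity F (fun s => (c s * c' s)%g) t.
Proof.
move=> lF FH cv cv'; have [i it] := atlas_cover (c t).
have [j jt] := atlas_cover (c' t); have [k kt] := atlas_cover (c t * c' t)%g.
exact: (has_velocity_mul lF.1 it jt kt (FH _ _ _ _ _ it jt kt) cv cv').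
Qed.

(** The points through which a solution exists for a given time are stable under
    products, and contain a neighborhood of the identity. *)
Lemma linear_uniform_flow X : lip_vfield X -> mul_related X X -> uniform_flow X.
Proof.
move=> lX XX; have [e e0 eP] := local_flow (1%g : G) lX; exists e => // g.
pose S : set G := [set g | exists c : R -> G,
  c 0 = g /\ forall t, -e < t < e -> has_velocity X c t].
have SM a b : S a -> S b -> S (a * b)%g.
  move=> [c [<- cv]] [c' [<- cv']]; exists (fun s => c s * c' s)%g; split=> // t te.
  by apply: (mul_has_velocity lX XX); [exact: cv|exact: cv'].
suff ST : S = [set: G] by have : [set: G] g by []; rewrite -ST.
apply: cG; first by exists 1%g; exact: (nbhs_singleton eP).
- exists S; last by rewrite setTI.
  rewrite openE => a Sa; suff : \forall b \near a, S b by [].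
  have c1 : {for a, continuous (fun b => a^-1 * b)%g}.
    have ca : {for a, continuous (fun _ : G => a^-1)%g} by exact: cst_continuous.
    have ci : {for a, continuous (fun b : G => b)} by exact: cvg_id.
    exact: (mul_continuous_at ca ci).
  have e1 : nbhs (a^-1 * a)%g S by rewrite mulVg; exact: eP.
  apply: filterS (near_continuous c1 e1) => b Sb.
  have -> : b = (a * (a^-1 * b))%g by rewrite mulgA mulgV mul1g.
  exact: SM.
- exists (closure S); first exact: closed_closure.
  rewrite setTI; apply/seteqP; split; first exact: subset_closure.
  move=> a Sa.
  have c1 : {for a, continuous (fun b => b^-1 * a)%g}.
    have ca : {for a, continuous (fun _ : G => a)} by exact: cst_continuous.
    have ci : {for a, continuous (fun b : G => b^-1)%g} by exact: lie_inv_continuous.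
    exact: (mul_continuous_at ci ca).
  have e1 : nbhs (a^-1 * a)%g S by rewrite mulVg; exact: eP.
  have [b [Sb Sba]] := Sa _ (near_continuous c1 e1).
  have -> : a = (b * (b^-1 * a))%g by rewrite mulgA mulgV mul1g.
  exact: SM.
Qed.

(** A local solution of [F] through the identity, multiplied by the solutions of
    [X], gives solutions of [F] through every point. *)
Lemma affine_uniform_flow F X : lip_vfield F -> mul_related F X ->
  uniform_flow X -> uniform_flow F.
Proof.
move=> lF FX [e e0 eP]; have [r r0 /nbhs_singleton[c [c1 cv]]] := local_flow (1%g : G) lF.
exists (Num.min e r); first by rewrite lt_min e0.
move=> g; have [c' [c'g cv']] := eP g; exists (fun s => c s * c' s)%g.
split=> [|t]; first by rewrite c1 c'g mul1g.
rewrite ltrNl !lt_min => /andP[/andP[te tr] /andP[te' tr']].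
by apply: (mul_has_velocity lF FX); [apply: cv|apply: cv']; rewrite ltrNl ?te ?tr.
Qed.

End flows.

(** * Solutions for a piecewise constant control *)

Lemma constant_on_midpoint (R : realType) (T : Type) (w : R -> T) (a b : R) :
  a < b -> (forall x y, a < x < b -> a < y < b -> w x = w y) ->
  exists u, forall s, a < s < b -> w s = u.
Proof.
move=> ab wab; exists (w ((a + b) / 2)) => s sab; apply: wab => //.
by rewrite midf_lt// midf_lt.
Qed.

Lemma piecewise_constant_right (R : realType) (T : Type) (w : R -> T) (t : R) :
  piecewise_constant w -> exists2 e : R, 0 < e &
    exists u, forall s, t < s < t + e -> w s = u.
Proof.
move=> pw; have t1 : t < t + 1 by rewrite ltrDl.
have [[|x s] [part ws]] := pw t (t + 1) t1.
  by move: t1; rewrite [X in _ < X](esym (itv_partition_nil part)) ltxx.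
have tx : t < x by case: part => /= /andP[].
exists (x - t); first by rewrite subr_gt0.
rewrite addrC subrK; apply: constant_on_midpoint tx _.
exact: (ws 0%N isT).
Qed.

Lemma piecewise_constant_left (R : realType) (T : Type) (w : R -> T) (t : R) :
  piecewise_constant w -> exists2 e : R, 0 < e &
    exists u, forall s, t - e < s < t -> w s = u.
Proof.
move=> pw; have t1 : t - 1 < t by rewrite gtrBl.
have [s] := pw (t - 1) t t1; case/lastP : s => [|s z] [part ws].
  by move: t1; rewrite (itv_partition_nil part) ltxx.
move: part ws => [sorted_s /eqP]; rewrite last_rcons => zt ws; subst z.
have yt : last (t - 1) s < t by move: sorted_s; rewrite rcons_path => /andP[].
exists (t - last (t - 1) s); first by rewrite subr_gt0.
rewrite subKr; apply: constant_on_midpoint yt _.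
have := ws (size s); rewrite size_rcons => /(_ (ltnSn _)).
by rewrite -rcons_cons !nth_rcons /= !ltnS leqnn ltnn eqxx -last_nth.
Qed.

Section systems.
Variables (R : realType) (d m : nat) (M : smoothManifoldType R d).
Variables (F : 'I_m.+1 -> vfield M) (w : R -> 'rV[R]_m).
Hypotheses (lF : forall u, lip_vfield (system_field F u)) (pw : piecewise_constant w).

Lemma solution_velocity (J : set R) (c : R -> M) (t a b : R) (u : 'rV[R]_m) :
  system_solution F w J c -> J t -> a < t < b -> (forall s, a < s < b -> w s = u) ->
  has_velocity (system_field F u) c t.
Proof.
move=> sc Jt tab wu; have [_] := sc t Jt; rewrite (wu _ tab); apply.
have : \forall s \near t, a < s < b by exact: near_itv.
by apply: filterS => s /wu.
Qed.

Lemma solution_unique (J : set R) (c c' : R -> M) (t1 : R) : is_interval J ->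
  system_solution F w J c -> system_solution F w J c' -> J t1 -> c t1 = c' t1 ->
  forall t, J t -> c t = c' t.
Proof.
move=> iJ sc sc' Jt1 e1; apply: (curve_unique iJ _ _ Jt1 e1).
  by move=> t Jt; split; [have [] := sc t Jt|have [] := sc' t Jt].
move=> t Jt; have [el el0 [ul wl]] := piecewise_constant_left t pw.
have [er er0 [ur wr]] := piecewise_constant_right t pw.
exists (Num.min el er), (system_field F ul), (system_field F ur); split=> //.
- by rewrite lt_min el0.
- move=> s Js /andP[s1 s2].
  have sl : t - el < s < t.
    by rewrite s2 andbT; apply: le_lt_trans s1; rewrite lerD2l lerN2 ge_min lexx.
  by split; [apply: (solution_velocity sc)|apply: (solution_velocity sc')]; eassumption.
- move=> s Js /andP[s1 s2].
  have sr : t < s < t + er.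
    by rewrite s1; apply: lt_le_trans s2 _; rewrite lerD2l ge_min lexx orbT.
  by split; [apply: (solution_velocity sc)|apply: (solution_velocity sc')]; eassumption.
Qed.

Hypothesis uF : forall u, uniform_flow (system_field F u).

Lemma uniform_flow_at H : uniform_flow H -> exists2 e : R, 0 < e &
  forall (t1 : R) (g : M), exists c : R -> M,
    c t1 = g /\ forall t, t1 - e < t < t1 + e -> has_velocity H c t.
Proof.
move=> [e e0 eP]; exists e => // t1 g; have [c [cg cv]] := eP g.
exists (fun s => c (s - t1)); split=> [|t /andP[t2 t3]]; first by rewrite subrr.
apply: has_velocity_shift; apply: cv; apply/andP; split; lra.
Qed.

Lemma glue_continuous (a b : R -> M) (t0 : R) : {for t0, continuous a} ->
  {for t0, continuous b} -> a t0 = b t0 ->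
  {for t0, continuous (fun s => if s <= t0 then a s else b s)}.
Proof.
move=> ca cb ab U; rewrite /= lexx => nU.
have nA : \forall s \near t0, U (a s) by exact: ca.
have nB : \forall s \near t0, U (b s) by apply: cb; rewrite -ab.
suff : \forall s \near t0, U (if s <= t0 then a s else b s) by [].
by apply: filterS2 nA nB => s As Bs; case: ifP.
Qed.

(** The control is constant on each side of [t0]: starting on one side, follow
    the field of that side up to [t0], then the field of the other. Since the
    times of existence do not depend on the starting point, neither does the
    interval obtained, and a solution that merely comes close to [t0] can be
    continued past it. *)
Lemma local_solution (t0 : R) : exists2 e : R, 0 < e &
  forall (t1 : R) (g : M), t0 - e < t1 < t0 + e -> exists c : R -> M,
    c t1 = g /\ system_solution F w [set t | t0 - e < t < t0 + e] c.
Proof.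
have [el el0 [ul wl]] := piecewise_constant_left t0 pw.
have [er er0 [ur wr]] := piecewise_constant_right t0 pw.
have [fl fl0 flP] := uniform_flow_at (uF ul).
have [fr fr0 frP] := uniform_flow_at (uF ur).
have [f0 f00 f0P] := uniform_flow_at (uF (w t0)).
pose e := Num.min (Num.min el er) (Num.min (fl / 2) (Num.min (fr / 2) (f0 / 2))).
have e0 : 0 < e by rewrite !lt_min el0 er0 !divr_gt0.
have [eel [eer [efl [efr ef0]]]] :
    e <= el /\ e <= er /\ e <= fl / 2 /\ e <= fr / 2 /\ e <= f0 / 2.
  by rewrite !ge_min !lexx ?orbT.
exists e => // t1 g /andP[t1l t1r].
have wl' s : t0 - e < s < t0 -> w s = ul.
  by move=> /andP[? ?]; apply: wl; apply/andP; split; lra.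
have wr' s : t0 < s < t0 + e -> w s = ur.
  by move=> /andP[? ?]; apply: wr; apply/andP; split; lra.
have [wc|wc] := pselect (\forall s \near t0, w s = w t0).
  (* No switching at [t0], so [ul = w t0 = ur] and one curve does it. *)
  have [c [cg cv]] := f0P t1 g; exists c; split=> // t /= /andP[tl tr].
  have vt : has_velocity (system_field F (w t0)) c t.
    by apply: cv; apply/andP; split; lra.
  split=> [|_]; first by case: vt.
  move: wc => /nbhs_ballP[r /= r0 rw].
  suff -> : w t = w t0 by [].
  pose q := Num.min (r / 2) (e / 2).
  have q0 : 0 < q by rewrite lt_min !divr_gt0.
  have [qr qe] : q <= r / 2 /\ q <= e / 2 by rewrite !ge_min !lexx orbT.
  have [tt0|tt0|-> //] := ltgtP t t0.
    have -> : w t = ul by apply: wl'; rewrite tl.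
    have <- : w (t0 - q) = ul by apply: wl'; apply/andP; split; lra.
    by apply: rw; rewrite -ball_normE /= opprB addrC subrK gtr0_norm//; lra.
  have -> : w t = ur by apply: wr'; rewrite tr tt0.
  have <- : w (t0 + q) = ur by apply: wr'; apply/andP; split; lra.
  by apply: rw; rewrite -ball_normE /= opprD addrA subrr sub0r normrN gtr0_norm//; lra.
have [a [b [ab ag va vb]]] : exists a b : R -> M, [/\ a t0 = b t0,
    (if t1 <= t0 then a t1 else b t1) = g,
    forall t, t0 - e < t < t0 + e -> has_velocity (system_field F ul) a t &
    forall t, t0 - e < t < t0 + e -> has_velocity (system_field F ur) b t].
  have [t10|t10] := leP t1 t0.
    have [a [ag va]] := flP t1 g; have [b [bg vb]] := frP t0 (a t0).
    exists a, b; split=> // t /andP[? ?]; [apply: va|apply: vb]; apply/andP; split; lra.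
  have [b [bg vb]] := frP t1 g; have [a [ag va]] := flP t0 (b t0).
  exists a, b; split=> // t /andP[? ?]; [apply: va|apply: vb]; apply/andP; split; lra.
exists (fun s => if s <= t0 then a s else b s); split=> // t /= tt.
have [av ac] : has_velocity (system_field F ul) a t /\ has_velocity (system_field F ur) b t.
  by split; [exact: va|exact: vb].
have [tt0|tt0|et] := ltgtP t t0.
- have nt : \forall s \near t, a s = (if s <= t0 then a s else b s).
    have : \forall s \near t, t - 1 < s < t0.
      by apply: near_itv; rewrite tt0 andbT; lra.
    by apply: filterS => s /andP[_ st]; rewrite ifT// ltW.
  have vt := near_has_velocity nt av; split=> [|_]; first by case: vt.
  by rewrite wl' // tt0 andbT; case/andP: tt.
- have nt : \forall s \near t, b s = (if s <= t0 then a s else b s).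
    have : \forall s \near t, t0 < s < t + 1.
      by apply: near_itv; rewrite tt0 /=; lra.
    by apply: filterS => s /andP[st _]; rewrite leNgt st.
  have vt := near_has_velocity nt ac; split=> [|_]; first by case: vt.
  by rewrite wr' // tt0 /=; case/andP: tt.
- rewrite et in tt av ac *; split=> //.
  by apply: glue_continuous => //; [case: av|case: ac].
Qed.
End systems.

(** * Global solutions *)

Section global_solutions.
Variables (R : realType) (d m : nat) (M : smoothManifoldType R d).
Variables (F : 'I_m.+1 -> vfield M) (w : R -> 'rV[R]_m).
Hypotheses (lF : forall u, lip_vfield (system_field F u)) (pw : piecewise_constant w).
Hypothesis uF : forall u, uniform_flow (system_field F u).

Lemma system_solution_sub (J K : set R) (c : R -> M) : K `<=` J ->
  system_solution F w J c -> system_solution F w K c.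
Proof. by move=> KJ sc t Kt; apply: sc; exact: KJ. Qed.

(** Being a solution is a local property of the curve. *)
Lemma solution_glue (J K : set R) (c c' : R -> M) : open K -> K `<=` J ->
  (forall t, K t -> c t = c' t) -> system_solution F w J c ->
  system_solution F w K c'.
Proof.
move=> oK KJ cc' sc t Kt.
have nt : \forall s \near t, c s = c' s.
  by apply: filterS (open_nbhs_nbhs (conj oK Kt)) => s; exact: cc'.
have [ct vt] := sc t (KJ _ Kt); split; last by move=> /vt; exact: near_has_velocity.
rewrite /prop_for /continuous_at -(nbhs_singleton nt); apply: cvg_trans ct.
exact: near_eq_cvg.
Qed.

Let open_itvoo (a b : R) : open [set t : R | a < t < b].
Proof.
by rewrite openE => t /= tab; suff : \forall s \near t, a < s < b by []; exact: near_itv.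
Qed.

Let reached (g : M) (t : R) (cJ : (R -> M) * set R) : Prop :=
  [/\ open cJ.2, is_interval cJ.2, cJ.2 0, cJ.2 t &
      system_solution F w cJ.2 cJ.1 /\ cJ.1 0 = g].

(** The set of reached times is open by definition. It is closed because a
    solution that reaches times close to [t0] is continued past [t0] by
    [local_solution]. *)
Lemma solution_reaches (g : M) (t : R) : exists cJ, reached g t cJ.
Proof.
have cT : connected [set: R] by apply/connected_intervalP.
suff BT : [set t | exists cJ, reached g t cJ] = [set: R].
  by have : [set: R] t by []; rewrite -BT.
apply: cT.
- have [e e0 eP] := local_solution pw uF 0; have [|c [cg sc]] := eP 0 g.
    by rewrite sub0r add0r oppr_lt0 e0.
  exists 0, (c, [set t | 0 - e < t < 0 + e]); split=> //=.
  + by move=> x y /andP[x0 x1] /andP[y0 y1] z /andP[xz zy]; apply/andP; split; lra.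
  + by apply/andP; split; lra.
  + by apply/andP; split; lra.
- exists [set t | exists cJ, reached g t cJ]; last by rewrite setTI.
  rewrite openE => s [[c J] [oJ iJ J0 Js sc]].
  suff : \forall s' \near s, exists cJ, reached g s' cJ by [].
  by apply: filterS (open_nbhs_nbhs (conj oJ Js)) => s' Js'; exists (c, J).
- exists (closure [set t | exists cJ, reached g t cJ]); first exact: closed_closure.
  rewrite setTI; apply/seteqP; split; first exact: subset_closure.
  move=> t0 ct0; have [e e0 eP] := local_solution pw uF t0.
  pose I := [set t : R | t0 - e < t < t0 + e].
  have It0 : I t0 by rewrite /I /=; apply/andP; split; lra.
  have oI : open I by exact: open_itvoo.
  have [t1 [[[c J] [/= oJ iJ J0 Jt1 [sc c0]]] It1]] :=
    ct0 _ (open_nbhs_nbhs (conj oI It0)).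
  have [c' [c't1 sc']] := eP t1 (c t1) It1.
  have iI : is_interval I.
    by move=> x y /andP[x0 x1] /andP[y0 y1] z /andP[xz zy]; apply/andP; split; lra.
  have cc' t' : J t' -> I t' -> c t' = c' t'.
    move=> Jt' It'; apply: (@solution_unique _ _ _ _ F w lF pw (J `&` I) c c' t1) => //.
    - move=> x y [Jx Ix] [Jy Iy] z zxy.
      by split; [exact: (iJ _ _ Jx Jy)|exact: (iI _ _ Ix Iy)].
    - by apply: system_solution_sub sc => ? [].
    - by apply: system_solution_sub sc' => ? [].
  pose c3 s := if `[< J s >] then c s else c' s.
  exists (c3, J `|` I); split=> /=.
  + exact: openU.
  + move=> x y xJI yJI z /andP[xz zy].
    have [zt|tz] := leP z t1.
      case: xJI => [Jx|Ix].
        by left; apply: (iJ _ _ Jx Jt1); rewrite xz.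
      by right; apply: (iI _ _ Ix It1); rewrite xz.
    case: yJI => [Jy|Iy].
      by left; apply: (iJ _ _ Jt1 Jy); rewrite zy ltW.
    by right; apply: (iI _ _ It1 Iy); rewrite zy ltW.
  + by left.
  + by right.
  + split; last by rewrite /c3 asboolT.
    have s1 : system_solution F w J c3.
      by apply: solution_glue sc => // s Js; rewrite /c3 asboolT.
    have s2 : system_solution F w I c3.
      apply: solution_glue sc' => // s Is; rewrite /c3.
      by case: asboolP => // Js; rewrite cc'.
    by move=> s [Js|Is]; [exact: s1|exact: s2].
Qed.

Lemma global_solution (g : M) : exists c : R -> M,
  system_solution F w setT c /\ c 0 = g.
Proof.
have [cJ cJP] := choice (solution_reaches g); exists (fun t => (cJ t).1 t).
split; last by have [_ _ _ _ []] := cJP 0.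
move=> t _; have [oJ iJ J0 Jt [sc c0]] := cJP t.
apply: (@solution_glue (cJ t).2 (cJ t).2 (cJ t).1) => // s Js.
have [oK iK K0 Ks [sc' c0']] := cJP s.
apply: (@solution_unique _ _ _ _ F w lF pw ((cJ t).2 `&` (cJ s).2) _ _ 0) => //.
- move=> x y [Jx Kx] [Jy Ky] z zxy.
  by split; [exact: (iJ _ _ Jx Jy)|exact: (iK _ _ Kx Ky)].
- by apply: system_solution_sub sc => ? [].
- by apply: system_solution_sub sc' => ? [].
- by rewrite c0 c0'.
Qed.
End global_solutions.

Lemma system_complete (R : realType) (d m : nat) (M : smoothManifoldType R d)
    (F : 'I_m.+1 -> vfield M) : (forall u, lip_vfield (system_field F u)) ->
  (forall u, uniform_flow (system_field F u)) -> complete_system F.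
Proof.
move=> lF uF w g pw; have [c [sc c0]] := global_solution lF pw uF g.
exists c; split=> // J c' oJ iJ J0 sc' c0' t Jt.
apply: (solution_unique lF pw iJ sc' _ J0) => //; last by rewrite c0 c0'.
by apply: system_solution_sub sc.
Qed.

(** * Affine systems *)

(** The end points [a] and [b] may be switching times, at which the solution is
    only known to be continuous. *)
Lemma solution_on_segment (R : realType) (d m : nat) (M : smoothManifoldType R d)
    (F : 'I_m.+1 -> vfield M) (w : R -> 'rV[R]_m) (u : 'rV[R]_m)
    (alpha : R -> M -> M) (c : R -> M) (a b : R) :
  lip_vfield (system_field F u) -> is_flow (system_field F u) alpha ->
  system_solution F w setT c -> (forall t, a < t < b -> w t = u) ->
  forall t, a <= t <= b -> c t = alpha (t - a) (c a).
Proof.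
move=> lF flow sc wu t tab.
have fv s : has_velocity (system_field F u) (fun s => alpha (s - a) (c a)) s.
  have [_ fl] := flow (c a).
  exact: (@has_velocity_shift _ _ _ _ (alpha ^~ (c a)) s a (fl (s - a))).
have cv s : a < s < b -> has_velocity (system_field F u) c s.
  by move=> sab; apply: (solution_velocity sc _ sab).
have ab : a <= b by case/andP: tab; exact: le_trans.
apply: (@curve_unique _ _ _ c (fun s => alpha (s - a) (c a)) [set s | a <= s <= b] a).
- by move=> x y /andP[x0 x1] /andP[y0 y1] z /andP[xz zy]; apply/andP; split; lra.
- by move=> s _; split; [have [] := sc s I|have [] := fv s].
- move=> s /= /andP[as_ sb].
  (* The neighborhood of [s] must not reach an end point other than [s]. *)
  have [e [e0 ea eb]] : exists e, [/\ 0 < e, a < s -> e <= s - a & s < b -> e <= b - s].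
    exists (Num.min (if a < s then s - a else 1) (if s < b then b - s else 1)).
    rewrite lt_min !ge_min; split=> [|->|->]; rewrite ?lexx ?orbT//.
    by apply/andP; split; case: ifP; rewrite // subr_gt0.
  exists e, (system_field F u), (system_field F u); split=> //.
  + move=> r /= /andP[ar rb] /andP[sr rs]; split=> //; apply: cv.
    by have es := ea (le_lt_trans ar rs); apply/andP; split; lra.
  + move=> r /= /andP[ar rb] /andP[sr rs]; split=> //; apply: cv.
    by have es := eb (lt_le_trans sr rb); apply/andP; split; lra.
- by rewrite /= lexx.
- by rewrite subrr; have [-> _] := flow (c a).
- exact: tab.
Qed.

Lemma system_solution_mul (R : realType) (d m : nat) (G : lieGroupType R d)
    (F X : 'I_m.+1 -> vfield G) (w : R -> 'rV[R]_m) (c c' : R -> G) :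
  (forall u, lip_vfield (system_field F u)) ->
  (forall u, mul_related (system_field F u) (system_field X u)) ->
  system_solution F w setT c -> system_solution X w setT c' ->
  system_solution F w setT (fun t => c t * c' t)%g.
Proof.
move=> lF FX sc sc' t Tt; have [ct vt] := sc t Tt; have [ct' vt'] := sc' t Tt.
split; first exact: mul_continuous_at.
by move=> wt; exact: (mul_has_velocity (lF _) (FX _) (vt wt) (vt' wt)).
Qed.

Theorem theorem4p1 (R : realType) (d m : nat) (G : lieGroupType R d)
    (hG : connected [set: G])
    (F X Y : 'I_m.+1 -> vfield G)
    (hF : forall j, affine_vfield (F j))
    (hX : forall j, linear_vfield (X j))
    (hY : forall j, right_invariant (Y j))
    (hFXY : forall j, eq_vfield (F j) (add_vfield (X j) (Y j))) :
  [/\ (forall phiA : R -> G -> (R -> 'rV[R]_m) -> G, solution_map F phiA ->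
       forall (w : R -> 'rV[R]_m), piecewise_constant w ->
       forall (n : nat) (tau : nat -> R) (v : nat -> 'rV[R]_m),
       tau 0%N = 0 ->
       (forall i, (1 <= i <= n)%N -> 0 < tau i) ->
       (forall i, (1 <= i <= n)%N -> forall t,
          \sum_(0 <= j < i) tau j < t <= \sum_(0 <= j < i.+1) tau j ->
          w t = v i) ->
       forall alpha : 'rV[R]_m -> R -> G -> G,
       (forall u, is_flow (system_field F u) (alpha u)) ->
       forall (x : G) (i : nat), (1 <= i <= n)%N ->
       forall t,
         \sum_(0 <= j < i) tau j < t <= \sum_(0 <= j < i.+1) tau j ->
         phiA t x w =
           alpha (v i) (t - \sum_(1 <= j < i) tau j)
             (flow_concat alpha v tau i.-1 x)),
      complete_system F &
      (forall phiA phiB : R -> G -> (R -> 'rV[R]_m) -> G,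
       solution_map F phiA -> solution_map X phiB ->
       forall (t : R) (w : R -> 'rV[R]_m), piecewise_constant w ->
         (fun g => phiA t g w) =
           left_translation (phiA t 1%g w) \o (fun g => phiB t g w))].
Proof.
have lF u : lip_vfield (system_field F u).
  by apply: lip_system => l; apply: smooth_lip; have [] := hF l.
have lX u : lip_vfield (system_field X u).
  by apply: lip_system => l; apply: smooth_lip; have [[]] := hX l.
have FX u : mul_related (system_field F u) (system_field X u).
  apply: system_mul_related => l.
  exact: (affine_mul_related hG (hFXY l) (hX l) (hY l)).
have XX u : mul_related (system_field X u) (system_field X u).
  by apply: system_mul_related => l; exact: linear_mul_related.
have uX u := linear_uniform_flow hG (lX u) (XX u).
have uF u := affine_uniform_flow (lF u) (FX u) (uX u).
split.
- move=> phiA phiAP w pw n tau v tau0 tau_gt0 wv alpha flow x.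
  have [sc c0] := phiAP x w pw.
  pose T k := \sum_(0 <= j < k.+1) tau j.
  have seg k t : (k < n)%N -> T k <= t <= T k.+1 ->
      phiA t x w = alpha (v k.+1) (t - T k) (phiA (T k) x w).
    move=> kn; apply: (solution_on_segment (lF _) (flow _) sc) => s /andP[s1 s2].
    by apply: (wv k.+1) => //; apply/andP; split=> //; exact: ltW.
  have TS k : T k.+1 = T k + tau k.+1 by rewrite /T big_nat_recr.
  (* [T k] is the end of the [k]-th interval, and [T 0 = tau 0 = 0]. *)
  have ends k : (k <= n)%N -> phiA (T k) x w = flow_concat alpha v tau k x.
    elim: k => [_|k ih kn]; first by rewrite /T big_nat1 tau0.
    rewrite (seg k)//; last by rewrite lexx TS lerDl ltW// tau_gt0.
    by rewrite ih ?(ltnW kn)// TS addrC addKr.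
  move=> [//|k] /= kn t /andP[t1 t2].
  have -> : \sum_(1 <= j < k.+1) tau j = T k by rewrite /T [RHS]big_ltn// tau0 add0r.
  by rewrite (seg k)// ?(ends k (ltnW kn))// ltW.
- exact: system_complete.
- move=> phiA phiB phiAP phiBP t w pw; apply/funext => g.
  rewrite /left_translation /=; have [sg g0] := phiAP g w pw.
  have [s1 g1] := phiAP 1%g w pw; have [sB gB] := phiBP g w pw.
  have sM := system_solution_mul lF FX s1 sB.
  apply: (solution_unique lF pw _ sg sM (t1 := 0)) => //.
  by rewrite g0 g1 gB mul1g.
Qed.
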